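(* The action of the Lie algebra $\mathfrak{X}_{\mathrm{vol}}(M)$ of divergence free vector fields on $M$ on level sets of the cotangent momentum map $$\mathbf{J}_R:T^*\operatorname{Emb}_{\mathrm{vol}}(S,M)\to\mathfrak{X}_{\mathrm{vol},\|}(S)^*,\qquad\mathbf{J}_R([\alpha_\varphi])=[\varphi^*\alpha_\varphi],$$ is not transitive (hence the action of the volume preserving diffeomorphism group $\operatorname{Diff}_{\mathrm{vol}}(M)$ on level sets of $\mathbf{J}_R$ is not transitive).
   Context: Setting. $S$ is a compact smooth manifold with nonempty smooth boundary $\partial S$, $M$ is a smooth manifold without boundary, $\dim S=\dim M=n$, and $\mu_S$, $\mu_M$ are volume forms on $S$, $M$. $\operatorname{Emb}(S,M)$ is the Fréchet manifold of smooth embeddings $S\to M$, and $\operatorname{Emb}_{\mathrm{vol}}(S,M)=\{\varphi\in\operatorname{Emb}(S,M):\varphi^*\mu_M=\mu_S\}$ is the Fréchet manifold of volume preserving embeddings, understood to be nonempty. $T_\varphi\operatorname{Emb}_{\mathrm{vol}}(S,M)$ consists of the smooth vector fields $v_\varphi:S\to TM$ along $\varphi$ such that $v_\varphi\circ\varphi^{-1}$ is a divergence free vector field (with respect to $\mu_M$) on $\varphi(S)$, not necessarily parallel to the boundary. Regular cotangent bundle. One-forms $\alpha_\varphi\in\Gamma(\varphi^*T^*M)$ along $\varphi$ are paired with vector fields along $\varphi$ by $\langle\alpha_\varphi,v_\varphi\rangle=\int_S(\alpha_\varphi\cdot v_\varphi)\mu_S$. For a one-form $\alpha_\varphi$ along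 $\varphi$, $\varphi^*\alpha_\varphi\in\Omega^1(S)$ is $(\varphi^*\alpha_\varphi)(s)(u_s)=\alpha_\varphi(s)(T_s\varphi(u_s))$. The regular cotangent space of $\operatorname{Emb}_{\mathrm{vol}}(S,M)$ is $$T^*_\varphi\operatorname{Emb}_{\mathrm{vol}}(S,M)=\Gamma(\varphi^*T^*M)/\{\alpha_\varphi:\varphi^*\alpha_\varphi=\mathbf{d}h,\ h\in C^\infty(S),\ h|_{\partial S}=0\},$$ with classes denoted $[\alpha_\varphi]$. Actions. $\operatorname{Diff}_{\mathrm{vol}}(M)$, the group of $\mu_M$-preserving diffeomorphisms of $M$, acts on $\operatorname{Emb}_{\mathrm{vol}}(S,M)$ on the left by $\varphi\mapsto\eta\circ\varphi$ and on $T^*\operatorname{Emb}_{\mathrm{vol}}(S,M)$ by the cotangent lift; for $v\in\mathfrak{X}_{\mathrm{vol}}(M)$, $v_{T^*\operatorname{Emb}_{\mathrm{vol}}(S,M)}$ is the infinitesimal generator on $T^*\operatorname{Emb}_{\mathrm{vol}}(S,M)$. $\mathfrak{X}_{\mathrm{vol},\|}(S)$ is the Lie algebra of divergence free vector fields on $S$ tangent to $\partial S$; its regular dual is identified with $\Omega^1(S)/\mathbf{d}\Omega^0(S)$ via $\langle[\beta],w\rangle=\int_S(\beta\cdot w)\mu_S$. $\mathbf{J}_R$ is the momentum map of the cotangent lift of the right action $\varphi\mapsto\varphi\circ\psi$ of $\operatorname{Diff}_{\mathrm{vol}}(S)$. Transitivity. A Lie algebra $\mathfrak{h}$ acting on a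 manifold $P$ acts transitively on level sets of a map $\mathbf{J}$ when $\{\xi_P(m):\xi\in\mathfrak{h}\}=\ker T_m\mathbf{J}$ for all $m\in P$; a group acts transitively on level sets when any two points of the same level set lie in the same orbit. *)

(* Defs.v *)
From HB Require Import structures.
From mathcomp Require Import all_boot all_order all_algebra.
From mathcomp Require Import all_classical all_reals all_analysis.
Import numFieldNormedType.Exports.
Set Implicit Arguments.
Unset Strict Implicit.
Unset Printing Implicit Defensive.
Import Order.TTheory GRing.Theory Num.Theory.
Local Open Scope classical_set_scope.
Local Open Scope ring_scope.

Section SmoothEuclidean.
Variables (R : realType) (m : nat) (W : normedModType R).
Implicit Types (f g : 'rV[R]_m -> W) (U A : set 'rV[R]_m).

Fixpoint Ck (k : nat) U f : Prop :=
  (forall x, U x -> {for x, continuous f}) /\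
  if k is j.+1 then
    forall v, (forall x, U x -> derivable f x v) /\ Ck j U ('D_v f)
  else True.

(* [A] is arbitrary: smooth on [A] means that [f] locally extends to a smooth
   map on an open set, as is usual at boundary points of a half-space. *)
Definition smooth_on A f : Prop :=
  forall x, A x -> exists U g,
    [/\ open U, U x, (forall k, Ck k U g) & forall y, A y -> U y -> g y = f y].

End SmoothEuclidean.

(* x_0 >= 0 in R^n; the quantifier makes the definition meaningful for n = 0,
   where the half-space is the point and has no boundary. *)
Definition half_space (R : realType) (n : nat) : set 'rV[R]_n :=
  [set x | forall i : 'I_n, val i = 0%N -> 0 <= x 0 i].
Definition half_space_bd (R : realType) (n : nat) : set 'rV[R]_n :=
  [set x | exists i : 'I_n, val i = 0%N /\ x 0 i = 0].

(* [param] is a total function; only its values on the image of [coord] matter. *)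
Record chart (R : realType) (n : nat) (T : Type) := Chart {
  dom : set T;
  coord : T -> 'rV[R]_n;
  param : 'rV[R]_n -> T }.

Definition img R n T (c : chart R n T) : set 'rV[R]_n := coord c @` dom c.

Definition is_chart R n (T : topologicalType) (c : chart R n T) : Prop :=
  [/\ open (dom c),
      exists2 O : set 'rV[R]_n, open O & img c = O `&` @half_space R n,
      forall x, dom c x -> param c (coord c x) = x,
      {within dom c, continuous (coord c)} &
      {within img c, continuous (param c)}].

Definition compatible R n (T : topologicalType) (c d : chart R n T) : Prop :=
  smooth_on (coord c @` (dom c `&` dom d)) (coord d \o param c).

(* Smooth n-manifold, possibly with boundary. *)
Record manifold (R : realType) (n : nat) := Manifold {
  carrier :> topologicalType;
  atlas : set (chart R n carrier);
  manifold_hausdorff : hausdorff_space carrier;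
  manifold_countable : @second_countable carrier;
  atlas_chart : forall c, atlas c -> is_chart c;
  atlas_cover : forall x, exists2 c, atlas c & dom c x;
  atlas_compatible : forall c d, atlas c -> atlas d -> compatible c d }.

Definition boundary R n (N : manifold R n) : set N :=
  [set x | exists c, [/\ @atlas R n N c, dom c x &
                         @half_space_bd R n (coord c x)]].

Section SmoothMaps.
Variables (R : realType) (n k : nat) (N : manifold R n) (M : manifold R k).

Definition smooth_fun (f : N -> R) : Prop :=
  forall c, @atlas R n N c -> smooth_on (W := R^o) (img c) (f \o param c).

(* f_t(x) smooth in (t, x), in the charts id x c of R x N. *)
Definition smooth_fun_family (f : R -> N -> R) : Prop :=
  forall c, @atlas R n N c ->
    smooth_on (W := R^o) [set u : 'rV[R]_(1 + n) | img c (rsubmx u)]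
      (fun u => f (lsubmx u 0 0) (param c (rsubmx u))).

Definition smooth_map (F : N -> M) : Prop :=
  continuous F /\
  forall c d, @atlas R n N c -> @atlas R k M d ->
    smooth_on [set u | img c u /\ dom d (F (param c u))]
      (fun u => coord d (F (param c u))).

Definition smooth_map_family (F : R -> N -> M) : Prop :=
  continuous (fun p : R * N => F p.1 p.2) /\
  forall c d, @atlas R n N c -> @atlas R k M d ->
    smooth_on
      [set u : 'rV[R]_(1 + n) | img c (rsubmx u) /\
         dom d (F (lsubmx u 0 0) (param c (rsubmx u)))]
      (fun u => coord d (F (lsubmx u 0 0) (param c (rsubmx u)))).

End SmoothMaps.

(* Tangent vectors are point derivations of the algebra of smooth functions.
   They are extended by 0 to non-smooth functions, so that equality of tangent
   vectors is Leibniz equality. *)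
Definition tvec R n (N : manifold R n) : Type := (N -> R) -> R.

Section Tangent.
Variables (R : realType) (n : nat) (N : manifold R n).

Definition tangent (p : N) (D : tvec N) : Prop :=
  [/\ forall f, ~ smooth_fun f -> D f = 0,
      forall (a : R) f g, smooth_fun f -> smooth_fun g ->
        D (fun x => a * f x + g x) = a * D f + D g &
      forall f g, smooth_fun f -> smooth_fun g ->
        D (fun x => f x * g x) = f p * D g + D f * g p].

(* Covectors, likewise extended by 0 outside of the tangent space. *)
Definition cotangent (p : N) (a : tvec N -> R) : Prop :=
  (forall D, ~ tangent p D -> a D = 0) /\
  forall (r : R) D E, tangent p D -> tangent p E ->
    a (fun f => r * D f + E f) = r * a D + a E.

(* Smoothness of tensor fields is tested on smooth functions and vector fields;
   on a manifold this agrees with smoothness of the components in charts. *)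
Definition vector_field (X : N -> tvec N) : Prop :=
  (forall p, tangent p (X p)) /\
  forall f, smooth_fun f -> smooth_fun (fun p => X p f).

Definition bracket (X Y : N -> tvec N) (p : N) : tvec N := fun f =>
  if `[< smooth_fun f >]
  then X p (fun q => Y q f) - Y p (fun q => X q f) else 0.

Definition nform : Type := N -> ('I_n -> tvec N) -> R.

Definition volume_form (mu : nform) : Prop :=
  [/\ forall p (v : 'I_n -> tvec N) i (r : R) D E,
        (forall j, tangent p (v j)) -> tangent p D -> tangent p E ->
        mu p [eta v with i |-> (fun f => r * D f + E f)] =
          r * mu p [eta v with i |-> D] + mu p [eta v with i |-> E],
      forall p (v : 'I_n -> tvec N) i j, (forall l, tangent p (v l)) ->
        i != j -> v i = v j -> mu p v = 0,
      forall X : 'I_n -> N -> tvec N, (forall i, vector_field (X i)) ->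
        smooth_fun (fun p => mu p (X^~ p)) &
      forall p, exists2 v, (forall i, tangent p (v i)) & mu p v != 0].

(* (L_xi mu)(X_1, ..., X_n)
     = xi(mu(X_1, ..., X_n)) - sum_i mu(X_1, ..., [xi, X_i], ..., X_n) *)
Definition lie_derivative (xi : N -> tvec N) (mu : nform)
    (X : 'I_n -> N -> tvec N) (p : N) : R :=
  xi p (fun q => mu q (X^~ q)) -
  \sum_(i < n) mu p [eta X^~ p with i |-> bracket xi (X i) p].

(* Divergence free smooth vector fields: L_xi mu = div(xi) mu = 0. *)
Definition X_vol (mu : nform) : set (N -> tvec N) :=
  [set xi | vector_field xi /\
     forall X p, (forall i, vector_field (X i)) ->
       lie_derivative xi mu X p = 0].

(* The differential d h. *)
Definition ext_d (h : N -> R) (p : N) (u : tvec N) : R :=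
  if `[< tangent p u >] then u h else 0.

End Tangent.

Section AlongMap.
Variables (R : realType) (n k : nat) (N : manifold R n) (M : manifold R k).


(* The tangent map T phi. *)
Definition push (phi : N -> M) (D : tvec N) : tvec M := fun f =>
  if `[< smooth_fun f >] then D (f \o phi) else 0.

(* Gamma(phi^* T^*M) *)
Definition oneform_along (phi : N -> M) (alpha : N -> tvec M -> R) : Prop :=
  (forall s, cotangent (phi s) (alpha s)) /\
  forall X, vector_field X -> smooth_fun (fun s => alpha s (X (phi s))).

(* phi^* alpha_phi *)
Definition pull (phi : N -> M) (alpha : N -> tvec M -> R)
    (s : N) (u : tvec N) : R :=
  if `[< tangent s u >] then alpha s (push phi u) else 0.

End AlongMap.

Definition oneform R n (N : manifold R n) : set (N -> tvec N -> R) :=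
  [set beta | oneform_along (fun x : N => x) beta].

Definition preserves R n (N M : manifold R n)
    (muN : nform N) (muM : nform M) (phi : N -> M) : Prop :=
  forall s v, (forall i, tangent s (v i)) ->
    muM (phi s) (fun i => push phi (v i)) = muN s v.

Definition embeddings R n k (N : manifold R n) (M : manifold R k) :
    set (N -> M) :=
  [set phi | [/\ smooth_map phi,
     forall s D, tangent s D -> push phi D = (fun=> 0) -> D = (fun=> 0),
     injective phi &
     forall U : set N, open U ->
       exists2 V : set M, open V & phi @` U = V `&` range phi]].

Definition Emb_vol R n (S M : manifold R n) (muS : nform S) (muM : nform M) :
    set (S -> M) :=
  [set phi | embeddings phi /\ preserves muS muM phi].

Definition Diff_vol R n (M : manifold R n) (muM : nform M) : set (M -> M) :=
  [set eta | [/\ smooth_map eta,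
     exists eta', [/\ smooth_map eta', cancel eta eta' & cancel eta' eta] &
     preserves muM muM eta]].

Section Cotangent.
Variables (R : realType) (n : nat) (S M : manifold R n).
Variables (muS : nform S) (muM : nform M).

(* A point of T^*Emb_vol is a base point phi together with a class [alpha_phi],
   the latter being the set of its representatives. *)
Definition covpoint : Type := (S -> M) * set (S -> tvec M -> R).

Definition class (phi : S -> M) (alpha : S -> tvec M -> R) : covpoint :=
  (phi, [set alpha' | oneform_along phi alpha' /\
     exists h : S -> R, [/\ smooth_fun h, forall s, boundary s -> h s = 0 &
       pull phi alpha' = (fun s u => pull phi alpha s u + ext_d h s u)]]).

Definition TstarEmb_vol : set covpoint :=
  [set m | exists phi alpha, [/\ Emb_vol muS muM phi,
     oneform_along phi alpha & m = class phi alpha]].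

(* The class [beta] in Omega^1(S)/dOmega^0(S), the regular dual of the
   divergence free vector fields tangent to the boundary. *)
Definition mod_exact (beta : S -> tvec S -> R) : set (S -> tvec S -> R) :=
  [set beta' | oneform beta' /\
     exists2 h, smooth_fun h & beta' = (fun s u => beta s u + ext_d h s u)].

(* J_R [alpha_phi] = [phi^* alpha_phi]; the union over the representatives is
   a union of equal classes. *)
Definition J_R (m : covpoint) : set (S -> tvec S -> R) :=
  \bigcup_(alpha in m.2) mod_exact (pull m.1 alpha).

(* alpha' = alpha o (T eta)^-1, a one-form along eta o phi. *)
Definition cotangent_lift (eta : M -> M) (phi : S -> M)
    (alpha alpha' : S -> tvec M -> R) : Prop :=
  forall s w, tangent (phi s) w -> alpha' s (push eta w) = alpha s w.

Definition act (eta : M -> M) (m : covpoint) : covpoint :=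
  (eta \o m.1, [set alpha' | oneform_along (eta \o m.1) alpha' /\
     exists2 alpha, m.2 alpha & cotangent_lift eta m.1 alpha alpha']).

Definition group_transitive_on_levels : Prop :=
  forall m1 m2, TstarEmb_vol m1 -> TstarEmb_vol m2 -> J_R m1 = J_R m2 ->
    exists2 eta, Diff_vol muM eta & act eta m1 = m2.

(* Tangent vectors of the Frechet manifold T^*Emb_vol are velocities at t = 0
   of its smooth curves t |-> [alpha_t], alpha_t along phi_t.  A smooth curve
   is given by a lift t |-> (phi_t, alpha_t); since S is compact, smoothness is
   joint smoothness in (t, s). *)
Definition curve : Type := R -> (S -> M) * (S -> tvec M -> R).

Definition smooth_curve (c : curve) : Prop :=
  [/\ forall t, Emb_vol muS muM (c t).1,
      forall t, oneform_along (c t).1 (c t).2,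
      smooth_map_family (fun t => (c t).1) &
      forall X, vector_field X ->
        smooth_fun_family (fun t s => (c t).2 s (X ((c t).1 s)))].

Definition at_point (m : covpoint) (c : curve) : Prop :=
  smooth_curve c /\ class (c 0).1 (c 0).2 = m.

(* For every s, the curves t |-> alpha_t(s) in T^*M defined by c and c' have the
   same position and velocity at t = 0.  A velocity in T^*M is determined by
   its effect on the functions f o pi, f smooth on M, and on the functions
   a |-> a(X(pi a)), X a vector field on M. *)
Definition same_velocity_lift (c c' : curve) : Prop :=
  [/\ c 0 = c' 0,
      forall f s, smooth_fun f ->
        derive1 (fun t : R => f ((c t).1 s) : R^o) 0 =
        derive1 (fun t : R => f ((c' t).1 s) : R^o) 0 &
      forall X s, vector_field X ->
        derive1 (fun t : R => (c t).2 s (X ((c t).1 s)) : R^o) 0 =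
        derive1 (fun t : R => (c' t).2 s (X ((c' t).1 s)) : R^o) 0].

(* Equality of velocities in the quotient: after replacing c' by another lift e
   of the same curve of T^*Emb_vol, i.e. after adding to alpha'_t a smooth curve
   of one-forms pulled back to d h_t with h_t = 0 on the boundary. *)
Definition same_velocity (c c' : curve) : Prop :=
  exists (e : curve) (h : R -> S -> R),
    [/\ smooth_curve e, smooth_fun_family h /\
          (forall t s, boundary s -> h t s = 0),
        forall t, (e t).1 = (c' t).1,
        forall t, pull (e t).1 (e t).2 =
          (fun s u => pull (c' t).1 (c' t).2 s u + ext_d (h t) s u) &
        same_velocity_lift c e].

Definition velocity (c : curve) : set curve :=
  [set c' | smooth_curve c' /\ same_velocity c c'].

(* The value of T J_R at the velocity of c: the derivative at t = 0 of
   [phi_t^* alpha_t] in the vector space Omega^1(S)/dOmega^0(S). *)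
Definition TJ_R (c : curve) : set (S -> tvec S -> R) :=
  mod_exact
    (fun s u => derive1 (fun t : R => pull (c t).1 (c t).2 s u : R^o) 0).

Definition ker_TJ_R (m : covpoint) : set (set curve) :=
  [set velocity c | c in
     [set c | at_point m c /\ TJ_R c = mod_exact (fun _ _ => 0)]].

(* Near t = 0, c is the orbit of c 0 under the cotangent lift of the flow of xi.
   As xi need not be complete, Fl is its flow for small times near the compact
   set phi_0(S) only (elsewhere it is arbitrary). *)
Definition lifted_flow_line (xi : M -> tvec M) (c : curve) : Prop :=
  exists (Fl : R -> M -> M) (U : set M) (eps : R),
    [/\ smooth_map_family Fl,
        open U /\ range (c 0).1 `<=` U,
        0 < eps,
        forall x, U x -> Fl 0 x = x /\
          forall t : R, `|t| < eps -> forall f, smooth_fun f ->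
            is_derive (t : R^o) (1 : R^o) (fun r => f (Fl r x) : R^o)
              (xi (Fl t x) f) &
        forall t, `|t| < eps -> (c t).1 = Fl t \o (c 0).1 /\
          cotangent_lift (Fl t) (c 0).1 (c 0).2 (c t).2].

(* xi_{T^*Emb_vol}(m), as a set of curves. *)
Definition generator (xi : M -> tvec M) (m : covpoint) : set curve :=
  \bigcup_(c in [set c | at_point m c /\ lifted_flow_line xi c]) velocity c.

Definition lie_algebra_transitive_on_levels : Prop :=
  forall m, TstarEmb_vol m ->
    [set generator xi m | xi in X_vol muM] = ker_TJ_R m.

End Cotangent.

(* Main.v *)
From HB Require Import structures.
Require Import Defs.
From mathcomp Require Import all_boot all_order all_algebra.
From mathcomp Require Import all_classical all_reals all_analysis.
From mathcomp Require Import ring lra.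
(* Again, so that [coord] denotes the coordinates of a chart. *)
Require Import Defs.
Import numFieldNormedType.Exports.
Set Implicit Arguments.
Unset Strict Implicit.
Unset Printing Implicit Defensive.
Import Order.TTheory GRing.Theory Num.Theory.
Local Open Scope classical_set_scope.
Local Open Scope ring_scope.

(** Why transitivity fails. In the regular cotangent space of the embeddings a
    form with exact pull-back [d h] is killed only if [h] vanishes on the
    boundary, whereas [J_R] forgets every exact pull-back. So let [f] be a smooth
    function on [M] and [k = f \o phi]. The class of the form [df] along [phi]
    lies on the same level set of [J_R] as the class of [0], and the velocity at
    [0] of the curve of classes of [t df] lies in the kernel of the tangent map
    of [J_R].

    A diffeomorphism [eta] that takes the class of [0] to that of [df] satisfies
    [eta \o phi = phi], so its tangent map is the identity on the vectors that
    are pushed forward by [phi]. The lifted action therefore does not change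
    pull-backs by [phi], and [d k = d h0] for some [h0] that vanishes on the
    boundary ([not_group_transitive]).

    A vector field [xi] that generates the velocity of [t df] does not move the
    base point [phi] to first order, so it vanishes on the image of [phi]; by
    uniqueness of solutions at an equilibrium ([stationary_flow]) its flow fixes that image,
    and again pull-backs by [phi] are constant along the lifted flow. Comparing
    derivatives at [t = 0] gives [d k + d h' = 0], where [h'] is the time
    derivative of functions that vanish on the boundary
    ([not_lie_algebra_transitive]). This exchanges a derivative in time with one
    in space ([schwarz], [dirder_time_derivative]), and tests the forms on
    vectors pushed forward by [phi], after extending them to vector fields on [M]
    ([vector_field_extension]).

    In both cases [k] differs from a function that vanishes on the boundary by a
    locally constant one ([zero_dirder_locally_constant]). This is absurd if [k]
    takes different values at two boundary points [p] and [q] at which all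
    locally constant functions agree. Since [phi] is injective, a bump function
    at [phi p] yields such a [k] ([separating_smooth_fun]); it remains to find
    [p] and [q] ([linked_boundary_points]). If [n >= 2], move along the boundary
    inside one chart. If [n = 1], the component of a boundary point [p] has to
    be followed to its other end: a maximal piece of curve starting at [p] exists
    by Zorn's lemma, and its end can be pushed further unless it runs into a
    boundary point; by compactness it does not run on forever, and it cannot
    close up because [p] is an end ([half_arc_other_end]).

    Tangent vectors are derivations and C^k is defined by iterated directional
    derivatives, so the calculus behind these steps (chain rule, symmetry of
    second derivatives, bump functions) is developed for that definition. Tangent
    vectors are only needed at interior points of charts, where they may be taken
    to be directional derivatives ([dirder]); the boundary is reached by
    continuity. *)

(** * Directional derivatives *)

Section Directional.
Variables (R : realType) (m : nat).

Lemma is_derive_line (W : normedModType R) (f : 'rV[R]_m -> W)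
    (x v : 'rV[R]_m) (s : R) :
  derivable f (x + s *: v) v ->
  is_derive (s : R^o) (1 : R^o) (fun r : R^o => f (x + r *: v))
    ('D_v f (x + s *: v)).
Proof.
have E : (fun h : R => h^-1 *: (f (x + (h *: (1 : R^o) + s) *: v) - f (x + s *: v))) =
         (fun h : R => h^-1 *: (f (h *: v + (x + s *: v)) - f (x + s *: v))).
  apply/funext => h; congr (_ *: (f _ - _)).
  by rewrite [h *: 1]mulr1 scalerDl addrCA.
by move=> df; split; rewrite /derivable /derive /= E.
Qed.

Lemma mean_value_line (f : 'rV[R]_m -> R^o) (x w : 'rV[R]_m) :
  (forall s : R, 0 <= s <= 1 -> derivable f (x + s *: w) w) ->
  exists2 s : R, 0 <= s <= 1 & f (x + w) - f x = 'D_w f (x + s *: w).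
Proof.
move=> df.
have [||c] := @MVT_segment R (fun r => f (x + r *: w))
    (fun r => 'D_w f (x + r *: w)) 0 1 ler01.
- move=> s; rewrite in_itv /= => /andP[s0 s1].
  by apply: is_derive_line; apply: df; rewrite !ltW.
- apply: derivable_within_continuous => s; rewrite in_itv /= => s01.
  by have [] := is_derive_line (df s s01).
rewrite in_itv /= => c01; rewrite scale1r scale0r addr0 subr0 mulr1 => fE.
by exists c.
Qed.

Lemma is_derive_scale_dir (W : normedModType R) (f : 'rV[R]_m -> W)
    (x v : 'rV[R]_m) (a : R) :
  derivable f x v -> is_derive x (a *: v) f (a *: 'D_v f x).
Proof.
move=> df.
have df' : derivable f (x + 0 *: v) v by rewrite scale0r addr0.
have [/derivable1_diffP d1 e1] := is_derive_line df'.
have H : is_derive (0 : R^o) (1 : R^o) (fun h : R^o => f (h *: (a *: v) + x))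
    (a *: 'D_v f x).
  have -> : (fun h : R^o => f (h *: (a *: v) + x)) =
      (fun r : R^o => f (x + r *: v)) \o ( *%R^~ a).
    by apply/funext => h /=; rewrite scalerA addrC.
  have dl : is_diff (0 : R^o) ( *%R^~ a : R^o -> R^o) ( *%R^~ a).
    have -> : ( *%R^~ a : R^o -> R^o) = ( *:%R a).
      by apply/funext => h; rewrite [RHS]mulrC.
    exact: is_diff_scaler.
  have d2 : differentiable (fun r : R^o => f (x + r *: v)) (0 * a : R^o).
    by rewrite mul0r.
  have [dc ec] := (is_diff_comp dl (@DiffDef _ _ _ _ _ _ _ d2 erefl)).
  split; first exact/derivable1_diffP.
  rewrite deriveE // ec /= mul1r mul0r.
  rewrite -{1}[a]mulr1 -[a * 1]/(a *: (1 : R^o)) linearZ /=.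
  by rewrite -deriveE // e1 scale0r addr0.
case: H => H1 H2; split; first exact/derivable1P.
rewrite -H2 /derive.
set F := (X in lim (X @ _)); set G := (X in _ = lim (X @ _)).
suff -> : F = G by [].
by apply/funext => h; rewrite /F /G /= addr0 scale0r add0r [h *: 1]mulr1.
Qed.

End Directional.

(** * Stability properties of C^k maps *)

Section CkClosure.
Variables (R : realType) (m : nat).
Implicit Types (U V : set 'rV[R]_m).

Lemma near_open (T : topologicalType) (U : set T) (x : T) :
  open U -> U x -> \forall y \near x, U y.
Proof. by move=> oU Ux; apply: open_nbhs_nbhs; split. Qed.

Lemma Ck_subset (W : normedModType R) k U V (f : 'rV[R]_m -> W) :
  V `<=` U -> Ck k U f -> Ck k V f.
Proof.
move=> VU; elim: k f => [|k IH] f [cf df]; split=> [x /VU /cf //|] // v.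
have [d1 d2] := df v; split; last exact: IH.
by move=> x /VU /d1.
Qed.

Lemma Ck_eq (W : normedModType R) k U (f g : 'rV[R]_m -> W) :
  open U -> (forall x, U x -> f x = g x) -> Ck k U f -> Ck k U g.
Proof.
move=> oU; elim: k f g => [|k IH] f g fg [cf df].
all: have nfg x : U x -> \forall y \near x, f y = g y
  by move=> Ux; apply: filterS (near_open oU Ux); exact: fg.
all: have cg x : U x -> {for x, continuous g}
  by move=> Ux; rewrite /prop_for /continuous_at -(fg x Ux);
     exact: cvg_trans (near_eq_cvg (nfg x Ux)) (cf x Ux).
- by split.
- split=> // v; have [d1 d2] := df v; split.
    by move=> x Ux; apply: near_eq_derivable (d1 x Ux); exact: nfg.
  by apply: IH d2 => x Ux; apply: near_eq_derive; exact: nfg.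
Qed.

Lemma Ck_continuous (W : normedModType R) k U (f : 'rV[R]_m -> W) (x : 'rV[R]_m) :
  Ck k U f -> U x -> {for x, continuous f}.
Proof. by case: k => [|k] [cf _]; exact: cf. Qed.

Lemma Ck_pred (W : normedModType R) k U (f : 'rV[R]_m -> W) :
  Ck k.+1 U f -> Ck k U f.
Proof.
elim: k f => [|k IH] f [cf df]; split=> // v.
by have [d1 /IH d2] := df v.
Qed.

Lemma Ck_cst (W : normedModType R) k U (a : W) : Ck k U (fun=> a).
Proof.
elim: k a => [|k IH] a; split=> [x Ux|]; try exact: cst_continuous.
  by [].
move=> v.
split=> [x _|]; first exact: derivable_cst.
have -> : 'D_v (fun=> a) = (fun=> 0) :> ('rV[R]_m -> W).
  by apply/funext => x; exact: derive_cst.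
exact: IH.
Qed.

Lemma Ck_add (W : normedModType R) k U (f g : 'rV[R]_m -> W) :
  open U -> Ck k U f -> Ck k U g -> Ck k U (fun x => f x + g x).
Proof.
move=> oU; elim: k f g => [|k IH] f g [cf df] [cg dg].
all: split=> [x Ux|]; try exact: continuousD (cf x Ux) (cg x Ux).
  by [].
move=> v; have [d1 d2] := df v; have [e1 e2] := dg v; split.
  by move=> x Ux; apply: derivableD; [exact: d1|exact: e1].
apply: Ck_eq (IH _ _ d2 e2) => // x Ux.
by rewrite -deriveD //; [exact: d1|exact: e1].
Qed.

Lemma Ck_sum (W : normedModType R) k U n (f : 'I_n -> 'rV[R]_m -> W) :
  open U -> (forall i, Ck k U (f i)) -> Ck k U (fun x => \sum_(i < n) f i x).
Proof.
move=> oU; elim: n f => [|n IH] f Hf.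
  by under eq_fun do rewrite big_ord0; exact: Ck_cst.
under eq_fun do rewrite big_ord_recl.
by apply: Ck_add => //; exact: IH.
Qed.

Lemma Ck_mul k U (f g : 'rV[R]_m -> R^o) :
  open U -> Ck k U f -> Ck k U g -> Ck k U (fun x => f x * g x : R^o).
Proof.
move=> oU; elim: k f g => [|k IH] f g Cf Cg.
all: split=> [x Ux|]; try exact: continuousM (Cf.1 x Ux) (Cg.1 x Ux).
  by [].
move=> v; have [d1 d2] := Cf.2 v; have [e1 e2] := Cg.2 v; split.
  by move=> x Ux; apply: derivableM; [exact: d1|exact: e1].
have H := Ck_add oU (IH _ _ (Ck_pred Cf) e2) (IH _ _ (Ck_pred Cg) d2).
by apply: Ck_eq H => // x Ux; rewrite -deriveM //; [exact: d1|exact: e1].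
Qed.

Lemma Ck_coord k U n (F : 'rV[R]_m -> 'rV[R]_n) (i : 'I_n) :
  open U -> Ck k U F -> Ck k U (fun x => F x 0 i : R^o).
Proof.
move=> oU; elim: k F => [|k IH] F [cF dF].
all: split=> [x Ux|].
- exact: (@continuous_comp _ _ _ F (fun M => M 0 i : R^o) x (cF x Ux)
    (@coord_continuous _ _ _ _ _ _)).
- by [].
- exact: (@continuous_comp _ _ _ F (fun M => M 0 i : R^o) x (cF x Ux)
    (@coord_continuous _ _ _ _ _ _)).
move=> v; have [d1 d2] := dF v; split.
  by move=> x Ux; move/derivable_mxP: (d1 x Ux); apply.
apply: Ck_eq (IH _ d2) => // x Ux.
by rewrite derive_mx ?mxE //; exact: d1.
Qed.

(** Directional derivatives are compatible with affine maps even where [f] is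
    not differentiable, so the target can be any normed space, in contrast with
    [Ck_comp]. *)
Lemma Ck_affine (W : normedModType R) n k (A : 'rV[R]_n -> 'rV[R]_m)
    (L : {linear 'rV[R]_n -> 'rV[R]_m}) (a : 'rV[R]_m) U (f : 'rV[R]_m -> W) :
  continuous A -> (forall x, A x = a + L x) -> open U ->
  Ck k U f -> Ck k (A @^-1` U) (f \o A).
Proof.
move=> cA AE oU.
have oV : open (A @^-1` U) by apply: open_comp => // x _; exact: cA.
elim: k f => [|k IH] f [cf df].
all: split=> [x Ux|].
- exact: (@continuous_comp _ _ _ A f x (cA x) (cf _ Ux)).
- by [].
- exact: (@continuous_comp _ _ _ A f x (cA x) (cf _ Ux)).
have E v x : (fun h : R => h^-1 *: ((f \o A) (h *: v + x) - (f \o A) x)) =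
             (fun h : R => h^-1 *: (f (h *: L v + A x) - f (A x))).
  apply/funext => h /=; congr (_ *: (f _ - _)).
  by rewrite !AE linearD linearZ addrCA.
have D v : 'D_v (f \o A) = 'D_(L v) f \o A.
  by apply/funext => x; rewrite /derive E.
move=> v; have [d1 d2] := df (L v); split.
  by move=> x Ux; rewrite /derivable E; exact: d1.
by rewrite D; exact: IH.
Qed.

End CkClosure.

(** * Continuously differentiable functions *)

Lemma continuous_epsP (R : realType) (V W : normedModType R) (f : V -> W) (x : V) :
  {for x, continuous f} <->
  forall e : R, 0 < e -> exists2 d : R, 0 < d &
    forall y, `|y - x| < d -> `|f y - f x| < e.
Proof.
split=> [cf e e0|H].
  move/(@cvgrPdist_lt _ _ _ _ (nbhs_filter x)): cf => /(_ e e0) /nbhs_ballP[d d0 df].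
  exists d => // y yx; rewrite distrC; apply: df.
  by rewrite -ball_normE /= distrC.
apply/(@cvgrPdist_lt _ _ _ _ (nbhs_filter x)) => e e0.
have [d d0 df] := H e e0; apply/nbhs_ballP; exists d => // y.
by rewrite -ball_normE /= distrC => /df; rewrite distrC.
Qed.

Lemma open_norm_ball (R : realType) (V : normedModType R) (U : set V) (x : V) :
  open U -> U x -> exists2 e : R, 0 < e & forall y, `|y - x| < e -> U y.
Proof.
move=> oU Ux; have /nbhs_ballP[e e0 eU] := near_open oU Ux.
by exists e => // y yx; apply: eU; rewrite -ball_normE /= distrC.
Qed.

Lemma norm_coord_le (R : realType) n (v : 'rV[R]_n) (i : 'I_n) : `|v 0 i| <= `|v|.
Proof.
rewrite [leRHS]/Num.Def.normr /= mx_normrE.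
exact: (le_bigmax 0 (fun ij : 'I_1 * 'I_n => `|v ij.1 ij.2|) (0, i)).
Qed.

(** ['d f x] is a chosen linear map, so exhibiting one first-order approximation
    is enough. *)
Lemma differentiable_approx (R : realType) (V W : normedModType R) (f : V -> W)
    (L : {linear V -> W}) (x : V) : continuous L ->
  (forall e : R, 0 < e ->
     \forall k \near (0 : V), `|f (k + x) - f x - L k| <= e * `|k|) ->
  differentiable f x.
Proof.
move=> cL H.
have fL : f \o shift x = cst (f x) + L +o_ 0 id.
  apply/eqaddoP => e /H; apply: filterS => k.
  by rewrite !fctE /= opprD addrA.
by apply/diff_locallyP; rewrite (diff_unique cL fL); split.
Qed.

Section ContinuouslyDifferentiable.
Variables (R : realType) (m : nat) (U : set 'rV[R]_m) (f : 'rV[R]_m -> R^o).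
Hypotheses (oU : open U) (df : forall x v, U x -> derivable f x v).

(** Move along [h v], then along [h w]: by the mean value theorem the second
    step contributes ['D_w f] at a point near [x], and continuity of ['D_w f] at
    [x] gives the limit. Linearity in the direction is not part of the
    definition of [Ck]; this is where it comes from. *)
Lemma is_derive_add_dir x v w : U x -> {for x, continuous ('D_w f)} ->
  is_derive x (v + w) f ('D_v f x + 'D_w f x).
Proof.
move=> Ux cw.
suff H : (fun h => h^-1 *: ((f \o shift x) (h *: (v + w)) - f x)) @ 0^' -->
    'D_v f x + 'D_w f x.
  by split; [apply/cvg_ex; eexists; exact: H|apply: cvg_lim => //; exact: H].
have E : (fun h => h^-1 *: ((f \o shift x) (h *: (v + w)) - f x)) =
   (fun h => h^-1 *: ((f \o shift x) (h *: v) - f x) +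
             h^-1 *: (f (h *: v + x + h *: w) - f (h *: v + x))).
  apply/funext => h /=; rewrite -scalerDr; congr (_ *: _).
  have -> : h *: (v + w) + x = h *: v + x + h *: w by rewrite scalerDr addrAC.
  by rewrite [RHS]addrC addrA subrK.
rewrite E; apply: (@cvgD _ R^o).
  exact: df.
apply/cvgrPdist_lt => e e0.
have [d d0 dU] := open_norm_ball oU Ux.
have [d' d'0 dw] := (continuous_epsP _ _).1 cw e e0.
set N := `|v| + `|w| + 1.
have N0 : 0 < N by rewrite /N ltr_wpDl ?addr_ge0.
near=> h.
have h0 : h != 0 by near: h; exact: nbhs_dnbhs_neq.
have hd : `|h| < Num.min d d' / N.
  by near: h; apply: dnbhs0_lt; rewrite divr_gt0 // lt_min d0.
have hs (s : R) : 0 <= s <= 1 -> `|h *: v + x + s *: (h *: w) - x| < Num.min d d'.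
  move=> /andP[s0 s1]; rewrite ltr_pdivlMr // in hd; apply: le_lt_trans hd.
  have -> : h *: v + x + s *: (h *: w) - x = h *: (v + s *: w).
    by rewrite scalerDr !scalerA (mulrC h s) addrAC addrK.
  rewrite normrZ ler_wpM2l //; apply: le_trans (ler_normD _ _) _.
  rewrite normrZ (ger0_norm s0) /N -addrA lerD2l.
  by rewrite (le_trans (ler_piMl _ s1)) // lerDl.
have hs1 (s : R) : 0 <= s <= 1 -> `|h *: v + x + s *: (h *: w) - x| < d.
  by move=> /hs; rewrite lt_min => /andP[].
have hs2 (s : R) : 0 <= s <= 1 -> `|h *: v + x + s *: (h *: w) - x| < d'.
  by move=> /hs; rewrite lt_min => /andP[].
have dh y : U y -> derivable f y (h *: w) by exact: df.
have [s s01 ->] := @mean_value_line R m f (h *: v + x) (h *: w) (fun s s01 =>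
   dh _ (dU _ (hs1 s s01))).
have [_ ->] := is_derive_scale_dir h (@df _ w (dU _ (hs1 s s01))).
by rewrite scalerA mulVf // scale1r distrC; apply: dw; exact: hs2.
Unshelve. all: by end_near. Qed.

Hypothesis cD : forall x v, U x -> {for x, continuous ('D_v f)}.

Lemma derive_basis x v : U x ->
  'D_v f x = \sum_(i < m) v 0 i * 'D_('e_i) f x.
Proof.
move=> Ux.
have lin : linear (fun v => 'D_v f x : R^o).
  move=> a u w; have [_ ->] := is_derive_add_dir (a *: u) Ux (@cD x w Ux).
  by have [_ ->] := is_derive_scale_dir a (@df x u Ux).
pose LM := GRing.isLinear.Build _ _ _ _ _ lin.
pose L : {linear _ -> _} := HB.pack (fun v => 'D_v f x : R^o) LM.
rewrite -[LHS]/(L v) {1}(row_sum_delta v) linear_sum.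
by apply: eq_bigr => i _; rewrite linearZ.
Qed.

(** By the mean value theorem the error at [k] is ['D_k f (x + s k) - 'D_k f x],
    which [derive_basis] expands over finitely many partial derivatives, all
    continuous at [x]. *)
Lemma C1_differentiable x : U x -> differentiable f x.
Proof.
move=> Ux.
pose c i := 'D_('e_i) f x.
pose l (v : 'rV[R]_m) := \sum_(i < m) v 0 i * c i : R^o.
have lin : linear l.
  move=> a u w; rewrite /l scaler_sumr -big_split /=.
  by apply: eq_bigr => i _; rewrite !mxE mulrDl -mulrA.
pose LM := GRing.isLinear.Build _ _ _ _ _ lin.
pose L : {linear 'rV[R]_m -> R^o} := HB.pack l LM.
have cL : continuous L.
  move=> v; apply/differentiable_continuous.
  have -> : (L : 'rV[R]_m -> R^o) =
      \sum_(i < m) (fun v : 'rV[R]_m => v 0 i * c i : R^o).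
    by apply/funext => u; rewrite fct_sumE.
  apply: (@differentiable_sum R _ _ m
    (fun i (v : 'rV[R]_m) => v 0 i * c i : R^o)) => i.
  apply: differentiableM; last exact: differentiable_cst.
  exact: differentiable_coord.
apply: (differentiable_approx cL) => e e0.
have [d d0 dU] := open_norm_ball oU Ux.
have e'0 : 0 < e / m.+1%:R by rewrite divr_gt0.
have dD : \forall d' \near (0 : R)^'+, forall i : 'I_m, forall y,
    `|y - x| < d' -> `|'D_('e_i) f y - c i| < e / m.+1%:R.
  apply: filter_forall => i.
  have [d' d'0 H] := (continuous_epsP _ _).1 (@cD x 'e_i Ux) _ e'0.
  near=> r => y yr; apply: H; apply: lt_le_trans yr _.
  by near: r; apply: nbhs_right_le.
have [d' [d'0 Hd']] : exists d' : R, 0 < d' /\ forall i : 'I_m, forall y,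
    `|y - x| < d' -> `|'D_('e_i) f y - c i| < e / m.+1%:R.
  near (0 : R)^'+ => r; exists r; split; first by near: r; exact: nbhs_right_gt.
  by near: r; exact: dD.
near=> k.
have kd : `|k| < Num.min d d'.
  by near: k; apply: (@nbhs0_lt R (matrix R 1 m)); rewrite lt_min d0.
have ks (s : R) : 0 <= s <= 1 -> `|x + s *: k - x| < Num.min d d'.
  move=> /andP[s0 s1]; rewrite addrAC subrr add0r normrZ ger0_norm //.
  by apply: le_lt_trans kd; rewrite ler_piMl.
have ks1 (s : R) : 0 <= s <= 1 -> `|x + s *: k - x| < d.
  by move=> /ks; rewrite lt_min => /andP[].
have ks2 (s : R) : 0 <= s <= 1 -> `|x + s *: k - x| < d'.
  by move=> /ks; rewrite lt_min => /andP[].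
have [s s01 fE] := @mean_value_line R m f x k (fun s s01 =>
   @df _ k (dU _ (ks1 s s01))).
have Us := dU _ (ks1 s s01).
rewrite (addrC k) fE derive_basis // /L /= /l -sumrB.
apply: le_trans (ler_norm_sum _ _ _) _.
apply: (@le_trans _ _ (\sum_(i < m) `|k| * (e / m.+1%:R))).
  apply: ler_sum => i _; rewrite -mulrBr normrM ler_pM ?norm_coord_le //.
  by apply/ltW/Hd'; exact: ks2.
rewrite sumr_const card_ord -[leLHS]mulr_natr -mulrA mulrC ler_wpM2r //.
by rewrite -mulrA ler_piMr ?(ltW e0) // mulrC ler_pdivrMr // mul1r ler_nat.
Unshelve. all: by end_near. Qed.

End ContinuouslyDifferentiable.

(** * Chain rule and symmetry of second derivatives *)

Section ChainRule.
Variables (R : realType) (m n : nat).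

Lemma is_derive_chain (V W : normedModType R) (G : 'rV[R]_m -> V)
    (f : V -> W) (x v : 'rV[R]_m) :
  derivable G x v -> differentiable f (G x) ->
  is_derive x v (f \o G) ('D_('D_v G x) f (G x)).
Proof.
move=> dG df.
have dG0 : derivable G (x + 0 *: v) v by rewrite scale0r addr0.
have [/derivable1_diffP d1 e1] := is_derive_line dG0.
have df' : differentiable f (G (x + (0 : R^o) *: v)) by rewrite scale0r addr0.
have [dc ec] := is_diff_comp (@DiffDef _ _ _ _ _ _ _ d1 erefl)
  (@DiffDef _ _ _ _ _ _ _ df' erefl).
have E : (fun r : R^o => (f \o G) (r *: v + x)) =
    f \o (fun r : R^o => G (x + r *: v)).
  by apply/funext => r /=; rewrite addrC.
have H : 'D_v (f \o G) x = 'D_(1 : R^o) (fun r : R^o => (f \o G) (r *: v + x)) 0.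
  rewrite /derive.
  set F := (X in lim (X @ _)); set F' := (X in _ = lim (X @ _)).
  suff -> : F = F' by [].
  by apply/funext => h; rewrite /F /F' /= addr0 scale0r add0r [h *: 1]mulr1.
split; first by apply/derivable1P; rewrite E; exact/derivable1_diffP.
rewrite H E deriveE // ec /= -(deriveE _ d1) e1.
by rewrite -deriveE // scale0r addr0.
Qed.

(** The derivatives of [f \o G] are sums of products of maps to which the
    induction hypothesis applies. *)
Lemma Ck_comp k (U : set 'rV[R]_m) (V : set 'rV[R]_n)
    (G : 'rV[R]_m -> 'rV[R]_n) (f : 'rV[R]_n -> R^o) :
  open U -> open V -> (forall x, U x -> V (G x)) ->
  Ck k U G -> Ck k V f -> Ck k U (f \o G).
Proof.
move=> oU oV UV; elim: k f => [|k IH] f CG Cf.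
all: split=> [x Ux|].
- exact: continuous_comp (CG.1 _ Ux) (Cf.1 _ (UV _ Ux)).
- by [].
- exact: continuous_comp (CG.1 _ Ux) (Cf.1 _ (UV _ Ux)).
have df y w : V y -> derivable f y w by exact: (Cf.2 w).1.
have cD y w : V y -> {for y, continuous ('D_w f)} by exact: Ck_continuous (Cf.2 w).2.
have chain x v : U x ->
    is_derive x v (f \o G) (\sum_(i < n) 'D_v G x 0 i * 'D_('e_i) f (G x)).
  move=> Ux; rewrite -(derive_basis oV df cD); last exact: UV.
  apply: is_derive_chain; first exact: (CG.2 v).1.
  by apply: (C1_differentiable oV df cD); exact: UV.
move=> v; split=> [x Ux|]; first by have [] := chain x v Ux.
apply: (@Ck_eq _ _ _ _ _
  (fun x => \sum_(i < n) 'D_v G x 0 i * 'D_('e_i) f (G x) : R^o)) => //.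
  by move=> x Ux; have [_ ->] := chain x v Ux.
apply: Ck_sum => // i; apply: Ck_mul => //.
  by apply: Ck_coord => //; exact: (CG.2 v).2.
by apply: (IH ('D_('e_i) f)); [exact: Ck_pred|exact: (Cf.2 _).2].
Qed.

End ChainRule.

Section MixedDerivatives.
Variables (R : realType) (m : nat) (U : set 'rV[R]_m) (f : 'rV[R]_m -> R^o).

(** The mean value theorem along [a], then along [b]. *)
Lemma second_difference (x a b : 'rV[R]_m) :
  (forall y, U y -> derivable f y a) ->
  (forall y, U y -> derivable ('D_a f) y b) ->
  (forall s t : R, 0 <= s <= 1 -> 0 <= t <= 1 -> U (x + s *: a + t *: b)) ->
  exists s t : R, [/\ 0 <= s <= 1, 0 <= t <= 1 &
    f (x + a + b) - f (x + a) - (f (x + b) - f x) =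
      'D_b ('D_a f) (x + s *: a + t *: b)].
Proof.
move=> da db Ux.
have dsh y : derivable f (y + b) a ->
    is_derive y a (fun y => f (y + b)) ('D_a f (y + b)).
  move=> d.
  have E : (fun h : R => h^-1 *: (f (h *: a + y + b) - f (y + b))) =
           (fun h : R => h^-1 *: (f (h *: a + (y + b)) - f (y + b))).
    by apply/funext => h; rewrite addrA.
  by split; rewrite /derivable /derive /= E.
have zo : 0 <= (0 : R) <= 1 by rewrite lexx ler01.
have oo : 0 <= (1 : R) <= 1 by rewrite lexx ler01.
pose g := (fun y => f (y + b)) - f : 'rV[R]_m -> R^o.
have dg (s : R) : 0 <= s <= 1 ->
    is_derive (x + s *: a) a g ('D_a f (x + s *: a + b) - 'D_a f (x + s *: a)).
  move=> s01; apply: is_deriveB.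
    by apply: dsh; apply: da; have := Ux s 1 s01 oo; rewrite scale1r.
  apply: derivableP; apply: da.
  by have := Ux s 0 s01 zo; rewrite scale0r addr0.
have [s s01 gE] := @mean_value_line R m g x a
  (fun s s01 => @ex_derive _ _ _ _ _ _ _ (dg s s01)).
have [t t01 hE] := @mean_value_line R m ('D_a f) (x + s *: a) b
  (fun t t01 => db _ (Ux s t s01 t01)).
exists s, t; split=> //; rewrite -hE.
have [_ <-] := dg s s01; rewrite -gE /g !fctE /=.
by rewrite !opprB addrACA; congr (_ + _); rewrite addrC.
Qed.

(** The second difference is symmetric in the two directions. On the
    parallelogram spanned by [h v] and [h w] it equals [h^2] times either mixed
    derivative, taken at some point near [x]. *)
Lemma schwarz (x v w : 'rV[R]_m) : open U -> Ck 2 U f -> U x ->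
  'D_v ('D_w f) x = 'D_w ('D_v f) x.
Proof.
move=> oU Cf Ux; apply/eqP; rewrite -subr_eq0 -normr_le0.
apply/ler_addgt0Pl => e e0; rewrite addr0.
have d1 a y : U y -> derivable f y a by exact: (Cf.2 a).1.
have d2 a b y : U y -> derivable ('D_a f) y b by exact: ((Cf.2 a).2.2 b).1.
have c2 a b : {for x, continuous ('D_b ('D_a f))}.
  exact: ((Cf.2 a).2.2 b).2.1.
have e20 : 0 < e / 2 by rewrite divr_gt0.
have [r0 r00 Hr0] := open_norm_ball oU Ux.
have [r1 r10 Hr1] := (continuous_epsP _ _).1 (c2 v w) _ e20.
have [r2 r20 Hr2] := (continuous_epsP _ _).1 (c2 w v) _ e20.
(* Within distance [r] of [x], [f] is C^2 and both mixed derivatives have nearly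
   their values at [x]; [h] is so small that the parallelogram stays there. *)
pose r := Num.min r0 (Num.min r1 r2).
have r_gt0 : 0 < r by rewrite !lt_min r00 r10.
pose h := r / (`|v| + `|w| + 1).
have N0 : 0 < `|v| + `|w| + 1 by rewrite ltr_wpDl ?addr_ge0.
have h0 : 0 < h by rewrite divr_gt0.
have near_x (s t : R) : 0 <= s <= 1 -> 0 <= t <= 1 ->
    `|x + s *: (h *: v) + t *: (h *: w) - x| < r.
  move=> /andP[s0 s1] /andP[t0 t1].
  have -> : x + s *: (h *: v) + t *: (h *: w) - x = h *: (s *: v + t *: w).
    by rewrite -[x + _ + _]addrA [x + _]addrC addrK scalerDr !scalerA
      (mulrC s) (mulrC t).
  rewrite normrZ gtr0_norm // /h mulrAC ltr_pdivrMr // ltr_pM2l //.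
  rewrite (le_lt_trans (ler_normD _ _)) // !normrZ !ger0_norm //.
  by rewrite (le_lt_trans (lerD (ler_piMl _ s1) (ler_piMl _ t1))) // ltrDl.
have H0 (s t : R) : 0 <= s <= 1 -> 0 <= t <= 1 ->
    U (x + s *: (h *: v) + t *: (h *: w)).
  move=> s01 t01; apply: Hr0; apply: lt_le_trans (near_x _ _ s01 t01) _.
  by rewrite /r ge_min lexx.
have H0' (s t : R) : 0 <= s <= 1 -> 0 <= t <= 1 ->
    U (x + s *: (h *: w) + t *: (h *: v)).
  by move=> s01 t01; rewrite addrAC; exact: H0.
have [s [t [s01 t01 E1]]] := second_difference
  (d1 (h *: v)) (d2 (h *: v) (h *: w)) H0.
have [s' [t' [s'01 t'01 E2]]] := second_difference
  (d1 (h *: w)) (d2 (h *: w) (h *: v)) H0'.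
have E : 'D_(h *: w) ('D_(h *: v) f) (x + s *: (h *: v) + t *: (h *: w)) =
    'D_(h *: v) ('D_(h *: w) f) (x + s' *: (h *: w) + t' *: (h *: v)).
  by rewrite -E1 -E2 (addrAC x) !opprB addrACA [RHS]addrACA [- f _ - f _]addrC.
have Dh a b y : U y -> 'D_(h *: b) ('D_(h *: a) f) y = h * (h * 'D_b ('D_a f) y).
  move=> Uy.
  have [_ ->] := is_derive_scale_dir h (d2 (h *: a) b y Uy).
  have -> : 'D_b ('D_(h *: a) f) y = 'D_b (fun z => h *: 'D_a f z) y.
    apply: near_eq_derive; apply: filterS (near_open oU Uy) => z Uz.
    by have [_ ->] := is_derive_scale_dir h (d1 a z Uz).
  by congr (h * _); exact: (@deriveZ R _ R^o ('D_a f) h y b (d2 a b y Uy)).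
rewrite (Dh v w _ (H0 _ _ s01 t01)) (Dh w v _ (H0' _ _ s'01 t'01)) in E.
have {}E := mulfI (lt0r_neq0 h0) (mulfI (lt0r_neq0 h0) E).
have A1 : `|'D_w ('D_v f) (x + s *: (h *: v) + t *: (h *: w)) -
    'D_w ('D_v f) x| < e / 2.
  apply: Hr1; apply: lt_le_trans (near_x _ _ s01 t01) _.
  by rewrite /r !ge_min lexx orbT.
have A2 : `|'D_v ('D_w f) (x + s' *: (h *: w) + t' *: (h *: v)) -
    'D_v ('D_w f) x| < e / 2.
  rewrite addrAC; apply: Hr2; rewrite addrAC.
  rewrite addrAC; apply: lt_le_trans (near_x _ _ t'01 s'01) _.
  by rewrite /r !ge_min lexx !orbT.
rewrite E in A1; rewrite distrC in A2.
apply: ltW; apply: le_lt_trans (ler_distD _ _ _) _; rewrite (splitr e).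
by apply: ltrD; [exact: A2|exact: A1].
Qed.

End MixedDerivatives.

(** * A smooth bump function *)

Section Bump.
Variable R : realType.

(** The case [k = 0] is the usual flat function. The derivative of [flat k] is a
    linear combination of [flat k.+1] and [flat k.+2], so the whole family is
    needed for an induction on the order of smoothness. *)
Definition flat (k : nat) (t : R) : R :=
  if 0 < t then t^-1 ^+ k * expR (- t^-1) else 0.

(** This is [exp s >= s^(k+1) / (k+1)!] at [s = 1/t]. It makes every [flat k]
    continuous at [0], and the difference quotient of [flat k] at [0] is [flat
    k.+1]. *)
Lemma flat_le k t : 0 < t -> flat k t <= k.+1`!%:R * t.
Proof.
move=> t0; rewrite /flat t0.
have F0 : 0 < k.+1`!%:R :> R by rewrite ltr0n fact_gt0.
have tV : 0 < t^-1 by rewrite invr_gt0.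
have H : t^-1 ^+ k.+1 / k.+1`!%:R <= expR t^-1.
  by apply: le_trans (expR_ge1Dxn k (ltW tV)); rewrite lerDr.
rewrite expRN ler_pdivrMr ?expR_gt0 // mulrAC -ler_pdivrMr // -exprSr.
by rewrite mulrC -ler_pdivrMr.
Qed.

Lemma is_derive_flat k (t : R) :
  is_derive (t : R^o) (1 : R^o) (flat k : R^o -> R^o)
    (flat k.+2 t - k%:R * flat k.+1 t).
Proof.
have [t0|t0|t0] := ltgtP t 0.
- have z j : flat j t = 0 by rewrite /flat ltNge (ltW t0).
  rewrite !z mulr0 subr0.
  apply: (@near_eq_is_derive R R^o R^o (cst 0)).
  near=> y; rewrite /flat /cst; case: ifP => // y0.
  have : y < 0 by near: y; exact: lt_nbhsl.
  by rewrite ltNge (ltW y0).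
- apply: (@near_eq_is_derive R R^o R^o (fun y : R => y^-1 ^+ k * expR (- y^-1))).
    near=> y; rewrite /flat ifT //; near: y; exact: lt_nbhsr.
  have tn0 : t != 0 by rewrite gt_eqF.
  have dV : is_derive (t : R^o) (1 : R^o) (fun y : R => y^-1) (- t ^- 2 *: 1).
    exact: (@is_deriveV R id).
  have dX := is_deriveX k dV.
  have dE : is_derive (t : R^o) (1 : R^o) (expR \o (fun y : R => - y^-1))
      (expR (- t^-1) * - (- t ^- 2 *: 1)).
    by apply: is_derive1_comp; exact: is_deriveN.
  have dM := is_deriveM dX dE.
  have Ef : (fun y : R => y^-1 ^+ k * expR (- y^-1)) =
      (fun y : R => y^-1) ^+ k * (expR \o (fun y : R => - y^-1)).
    by apply/funext => y; rewrite /= exprfctE.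
  rewrite Ef; apply: (is_derive_eq dM).
  rewrite /flat t0 /= !exprfctE /= -![_ *: _]/(_ * _) !mulr1 opprK.
  case: k {dX dM Ef} => [|k] /=; rewrite ?expr0 ?exprS; field; exact: tn0.
- rewrite t0; have z j : flat j 0 = 0 by rewrite /flat ltxx.
  rewrite !z mulr0 subr0.
  have E : (fun h : R => h^-1 *: (flat k (h *: (1 : R^o) + 0) - flat k 0)) =
      flat k.+1.
    apply/funext => h; rewrite z subr0 addr0 [h *: 1]mulr1 /flat.
    by case: ifP; rewrite ?scaler0 // exprS -mulrA.
  have H : flat k.+1 @ (0 : R)^' --> (0 : R).
    apply/cvgrPdist_le => e e0; near=> h; rewrite sub0r normrN.
    have [h0|h0] := ltP 0 h; last by rewrite /flat ltNge h0 normr0 ltW.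
    rewrite ger0_norm; last by rewrite /flat h0 mulr_ge0 ?expR_ge0 ?exprn_ge0 // invr_ge0 ltW.
    apply: le_trans (flat_le _ h0) _; rewrite mulrC -ler_pdivlMr ?ltr0n ?fact_gt0 //.
    apply: ltW; apply: le_lt_trans (ler_norm _) _; near: h.
    by apply: dnbhs0_lt; rewrite divr_gt0 // ltr0n fact_gt0.
  split; first by rewrite /derivable /= E; apply/cvg_ex; exists 0.
  by rewrite /derive /= E; apply: cvg_lim.
Unshelve. all: by end_near. Qed.

Variables (n : nat) (a : 'rV[R]_n) (r : R).

Lemma Ck_id (m : nat) k (U : set 'rV[R]_m) : Ck k U (id : 'rV[R]_m -> 'rV[R]_m).
Proof.
case: k => [|k]; split=> [x _|]; try exact: cvg_id; first by [].
move=> v; split=> [x _|]; first exact: derivable_id.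
have -> : 'D_v (id : 'rV[R]_m -> 'rV[R]_m) = fun=> v.
  by apply/funext => x; rewrite derive_id.
exact: Ck_cst.
Qed.

Definition bump_arg (x : 'rV[R]_n) : R := r ^+ 2 - \sum_i (x 0 i - a 0 i) ^+ 2.
Definition bump (x : 'rV[R]_n) : R := flat 0 (bump_arg x).

Lemma Ck_bump_arg k (U : set 'rV[R]_n) : open U -> Ck (W := R^o) k U bump_arg.
Proof.
move=> oU; rewrite /bump_arg.
have -> : (fun x : 'rV[R]_n => r ^+ 2 - \sum_i (x 0 i - a 0 i) ^+ 2) =
  fun x => r ^+ 2 + \sum_(i < n) -1 * ((x 0 i - a 0 i) * (x 0 i - a 0 i)).
  by apply/funext => x; rewrite -mulr_sumr mulN1r.
apply: (@Ck_add _ _ R^o) => //; first exact: Ck_cst.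
apply: (@Ck_sum _ _ R^o) => // i; apply: Ck_mul => //; first exact: Ck_cst.
have C : Ck (W := R^o) k U (fun x : 'rV[R]_n => x 0 i - a 0 i).
  apply: (@Ck_add _ _ R^o) => //; last exact: Ck_cst.
  exact: (Ck_coord i oU (@Ck_id _ _ _)).
exact: Ck_mul.
Qed.

Lemma Ck_bump k (U : set 'rV[R]_n) : open U -> Ck (W := R^o) k U bump.
Proof.
move=> oU.
suff H j : Ck (W := R^o) k U (fun x => flat j (bump_arg x)) by exact: H.
have dq (x v : 'rV[R]_n) : derivable (bump_arg : 'rV[R]_n -> R^o) x v.
  exact: ((Ck_bump_arg 1 (@openT 'rV[R]_n)).2 v).1.
have cont j' (x : 'rV[R]_n) :
    {for x, continuous (fun x : 'rV[R]_n => flat j' (bump_arg x) : R^o)}.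
  apply: (@continuous_comp _ _ _ (bump_arg : 'rV[R]_n -> R^o) (flat j' : R^o -> R^o)).
    exact: (Ck_bump_arg 0 (@openT 'rV[R]_n)).1.
  apply: differentiable_continuous; apply/derivable1_diffP.
  by have [] := is_derive_flat j' (bump_arg x).
have chain j' (x v : 'rV[R]_n) : is_derive x v (fun x : 'rV[R]_n => flat j' (bump_arg x) : R^o)
    ('D_v (bump_arg : 'rV[R]_n -> R^o) x *
      (flat j'.+2 (bump_arg x) - j'%:R * flat j'.+1 (bump_arg x))).
  have [d1 d2] := is_derive_flat j' (bump_arg x).
  have [c1 c2] := is_derive_chain (dq x v) ((derivable1_diffP _ _).1 d1).
  split; first exact: c1.
  rewrite [LHS]c2 deriveE; last exact/derivable1_diffP.
  by rewrite deriv1E // derive1E d2.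
elim: k j => [|k IH] j; split=> //.
move=> v; split=> [x _|]; first by have [] := chain j x v.
apply: (@Ck_eq _ _ R^o _ _ (fun x : 'rV[R]_n => 'D_v (bump_arg : 'rV[R]_n -> R^o) x *
      (flat j.+2 (bump_arg x) + - j%:R * flat j.+1 (bump_arg x)))) => //.
  by move=> x _; have [_ ->] := chain j x v; rewrite mulNr.
apply: Ck_mul => //; first exact: ((Ck_bump_arg k.+1 oU).2 v).2.
apply: (@Ck_add _ _ R^o) => //; apply: Ck_mul => //; exact: Ck_cst.
Qed.

Lemma bump_gt0 : 0 < r -> 0 < bump a.
Proof.
move=> r0; rewrite /bump /flat /bump_arg big1 => [|i _]; last first.
  by rewrite subrr expr0n.
by rewrite subr0 exprn_gt0 // expr0 mul1r expR_gt0.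
Qed.

(** The Euclidean ball of radius [r] is contained in the ball of the maximum
    norm. *)
Lemma bump_supp x : 0 < r -> bump x != 0 -> `|x - a| < r.
Proof.
move=> r0; rewrite /bump /flat; case: ifP; last by rewrite eqxx.
rewrite subr_gt0 => H _.
have xi (i : 'I_n) : `|(x - a) 0 i| < r.
  rewrite !mxE -ltr_sqr ?nnegrE ?(ltW r0) // real_normK ?num_real //.
  apply: le_lt_trans H; rewrite (bigD1 i) //= lerDl.
  by apply: sumr_ge0 => j _; exact: sqr_ge0.
rewrite /Num.Def.normr /= mx_normrE; apply/bigmax_ltP; split=> // -[i j] _ /=.
by rewrite (ord1 i).
Qed.

End Bump.

(** * Smooth functions and smooth maps on manifolds *)

Section SmoothOn.
Variable R : realType.

Lemma within_continuous_open (T T' : topologicalType) (A : set T) (f : T -> T')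
    (V : set T') (x : T) :
  {within A, continuous f} -> open V -> A x -> V (f x) ->
  exists2 U, open U /\ U x & forall y, A y -> U y -> V (f y).
Proof.
move=> /subspace_continuousP cf oV Ax Vfx.
have : within A (nbhs x) (f @^-1` V) by apply: cf => //; exact: near_open.
rewrite /within /= nbhsE => -[U [oU Ux] UV].
by exists U => // y Ay Uy; exact: UV.
Qed.

Lemma open_setI_preimage (T T' : topologicalType) (U : set T) (V : set T')
    (f : T -> T') :
  open U -> open V -> (forall x, U x -> {for x, continuous f}) ->
  open (U `&` f @^-1` V).
Proof.
move=> oU oV cf; rewrite openE => x [Ux Vfx]; rewrite /interior.
by apply: filterI; [exact: near_open|apply: cf => //; exact: near_open].
Qed.

Section Source.
Variable m : nat.

Lemma Ck_local (W : normedModType R) k (U : set 'rV[R]_m) (f : 'rV[R]_m -> W) :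
  (forall x, U x -> exists2 V, open V /\ V x & Ck k (V `&` U) f) -> Ck k U f.
Proof.
elim: k f => [|k IH] f H.
all: split=> [x Ux|].
- by have [V [oV Vx] [cf _]] := H x Ux; exact: cf.
- by [].
- by have [V [oV Vx] [cf _]] := H x Ux; exact: cf.
move=> v; split=> [x Ux|]; first by have [V [oV Vx] [_ /(_ v)[+ _]]] := H x Ux; apply.
apply: IH => x Ux; have [V [oV Vx] [_ /(_ v)[_ C]]] := H x Ux.
by exists V.
Qed.

(** On an open set, the local extensions of the definition of [smooth_on]
    coincide with the function near each point. *)
Lemma smooth_on_Ck (W : normedModType R) (A U : set 'rV[R]_m)
    (f : 'rV[R]_m -> W) k :
  smooth_on A f -> open U -> U `<=` A -> Ck k U f.
Proof.
move=> sf oU UA; apply: Ck_local => x Ux.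
have [V [g [oV Vx Cg gf]]] := sf x (UA _ Ux).
exists V => //; apply: (@Ck_eq _ _ _ _ _ g); first exact: openI.
  by move=> y [Vy Uy]; apply: gf => //; exact: UA.
by apply: Ck_subset (Cg k) => y [].
Qed.

Lemma Ck_smooth_on (W : normedModType R) (A U : set 'rV[R]_m)
    (f : 'rV[R]_m -> W) :
  (forall k, Ck k U f) -> open U -> A `<=` U -> smooth_on A f.
Proof. by move=> Cf oU AU x /AU Ux; exists U, f. Qed.

Lemma smooth_on_eq (W : normedModType R) (A : set 'rV[R]_m)
    (f g : 'rV[R]_m -> W) :
  (forall x, A x -> f x = g x) -> smooth_on A f -> smooth_on A g.
Proof.
move=> fg sf x Ax; have [U [h [oU Ux Ch hf]]] := sf x Ax.
by exists U, h; split=> // y Ay Uy; rewrite hf // fg.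
Qed.

Lemma smooth_on_sub (W : normedModType R) (A B : set 'rV[R]_m)
    (f : 'rV[R]_m -> W) : B `<=` A -> smooth_on A f -> smooth_on B f.
Proof.
move=> BA sf x /BA Ax; have [U [h [oU Ux Ch hf]]] := sf x Ax.
by exists U, h; split=> // y /BA Ay Uy; rewrite hf.
Qed.

Lemma smooth_on_local (W : normedModType R) (A : set 'rV[R]_m)
    (f : 'rV[R]_m -> W) :
  (forall x, A x -> exists2 U, open U /\ U x & smooth_on (A `&` U) f) ->
  smooth_on A f.
Proof.
move=> H x Ax; have [V [oV Vx] sf] := H x Ax.
have [U [h [oU Ux Ch hf]]] := sf x (conj Ax Vx).
exists (V `&` U), h; split=> //; first exact: openI.
  by move=> k; apply: Ck_subset (Ch k) => y [].
by move=> y Ay [Vy Uy]; exact: hf.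
Qed.

Lemma smooth_on_cst (W : normedModType R) (A : set 'rV[R]_m) (a : W) :
  smooth_on A (fun=> a).
Proof.
move=> x _; exists setT, (fun=> a); split=> //; first exact: openT.
by move=> k; exact: Ck_cst.
Qed.

Lemma smooth_on_add (W : normedModType R) (A : set 'rV[R]_m)
    (f g : 'rV[R]_m -> W) :
  smooth_on A f -> smooth_on A g -> smooth_on A (fun x => f x + g x).
Proof.
move=> sf sg x Ax; have [U [h [oU Ux Ch hf]]] := sf x Ax.
have [V [l [oV Vx Cl lg]]] := sg x Ax.
exists (U `&` V), (fun x => h x + l x); split=> //; first exact: openI.
- move=> k; apply: Ck_add; first exact: openI.
    by apply: Ck_subset (Ch k) => y [].
  by apply: Ck_subset (Cl k) => y [].
- by move=> y Ay [Uy Vy]; rewrite hf // lg.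
Qed.

Lemma smooth_on_mul (A : set 'rV[R]_m) (f g : 'rV[R]_m -> R^o) :
  smooth_on A f -> smooth_on A g -> smooth_on A (fun x => f x * g x : R^o).
Proof.
move=> sf sg x Ax; have [U [h [oU Ux Ch hf]]] := sf x Ax.
have [V [l [oV Vx Cl lg]]] := sg x Ax.
exists (U `&` V), (fun x => h x * l x); split=> //; first exact: openI.
- move=> k; apply: Ck_mul; first exact: openI.
    by apply: Ck_subset (Ch k) => y [].
  by apply: Ck_subset (Cl k) => y [].
- by move=> y Ay [Uy Vy]; rewrite hf // lg.
Qed.

Lemma smooth_on_comp n (A : set 'rV[R]_m) (B : set 'rV[R]_n)
    (G : 'rV[R]_m -> 'rV[R]_n) (f : 'rV[R]_n -> R^o) :
  smooth_on A G -> smooth_on B f -> (forall x, A x -> B (G x)) ->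
  smooth_on A (f \o G).
Proof.
move=> sG sf AB x Ax; have [U [h [oU Ux Ch hG]]] := sG x Ax.
have [V [l [oV Vx Cl lf]]] := sf _ (AB _ Ax).
have oUV : open (U `&` h @^-1` V).
  by apply: open_setI_preimage => // y Uy; exact: Ck_continuous (Ch 0%N) Uy.
exists (U `&` h @^-1` V), (l \o h); split=> //.
- by split=> //=; rewrite hG.
- move=> k; apply: (Ck_comp oUV oV _ _ (Cl k)); first by move=> y [].
  by apply: Ck_subset (Ch k) => y [].
- by move=> y Ay [Uy Vy] /=; rewrite -hG // lf // hG //; exact: AB.
Qed.

Lemma smooth_on_affine (W : normedModType R) n (A : 'rV[R]_n -> 'rV[R]_m)
    (L : {linear 'rV[R]_n -> 'rV[R]_m}) (a : 'rV[R]_m) (B : set 'rV[R]_m)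
    (f : 'rV[R]_m -> W) :
  continuous A -> (forall x, A x = a + L x) ->
  smooth_on B f -> smooth_on (A @^-1` B) (f \o A).
Proof.
move=> cA AE sf x Bx; have [U [h [oU Ux Ch hf]]] := sf _ Bx.
exists (A @^-1` U), (h \o A); split=> //.
- by apply: open_comp => // y _; exact: cA.
- by move=> k; exact: Ck_affine cA AE oU (Ch k).
- by move=> y By Uy /=; rewrite hf.
Qed.

End Source.
End SmoothOn.

Section SmoothFun.
Variables (R : realType) (n : nat) (N : manifold R n).
Implicit Types (c : chart R n N) (f g : N -> R).

Lemma atlas_param c x : @atlas R n N c -> dom c x -> param c (coord c x) = x.
Proof. by move=> /atlas_chart[_ _ H _ _]; exact: H. Qed.

Lemma img_param c u : @atlas R n N c -> img c u ->
  dom c (param c u) /\ coord c (param c u) = u.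
Proof. by move=> ac [x dx <-]; rewrite atlas_param. Qed.

Lemma param_near c (V : set N) u : @atlas R n N c -> open V -> img c u ->
  V (param c u) ->
  exists2 U, open U /\ U u & forall y, img c y -> U y -> V (param c y).
Proof.
by move=> /atlas_chart[_ _ _ _ cp] oV cu Vu; exact: within_continuous_open cp oV cu Vu.
Qed.

Lemma smooth_fun_cst (a : R) : smooth_fun (fun _ : N => a).
Proof. by move=> c ac; exact: smooth_on_cst. Qed.

Lemma smooth_funD f g : smooth_fun f -> smooth_fun g ->
  smooth_fun (fun x => f x + g x).
Proof. by move=> sf sg c ac; exact: (smooth_on_add (sf c ac) (sg c ac)). Qed.

Lemma smooth_funM f g : smooth_fun f -> smooth_fun g ->
  smooth_fun (fun x => f x * g x).
Proof. by move=> sf sg c ac; exact: (smooth_on_mul (sf c ac) (sg c ac)). Qed.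

Lemma smooth_funZ (a : R) f : smooth_fun f -> smooth_fun (fun x => a * f x).
Proof. by move=> sf; apply: smooth_funM => //; exact: smooth_fun_cst. Qed.

Lemma smooth_funB f g : smooth_fun f -> smooth_fun g ->
  smooth_fun (fun x => f x - g x).
Proof.
move=> sf sg; have -> : (fun x => f x - g x) = fun x => f x + -1 * g x.
  by apply/funext => x; rewrite mulN1r.
by apply: smooth_funD => //; exact: smooth_funZ.
Qed.

Lemma smooth_fun_sum k (f : 'I_k -> N -> R) : (forall i, smooth_fun (f i)) ->
  smooth_fun (fun x => \sum_(i < k) f i x).
Proof.
elim: k f => [|k IH] f sf.
  by under eq_fun do rewrite big_ord0; exact: smooth_fun_cst.
under eq_fun do rewrite big_ord_recl.
by apply: smooth_funD => //; exact: IH.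
Qed.

End SmoothFun.

Section SmoothMapComp.
Variables (R : realType) (n k : nat) (N : manifold R n) (M : manifold R k).

Lemma smooth_fun_comp (F : N -> M) (f : M -> R) :
  smooth_map F -> smooth_fun f -> smooth_fun (f \o F).
Proof.
move=> [cF sF] sf c ac; apply: smooth_on_local => u cu.
have [d ad dx] := atlas_cover (F (param c u)).
have [od _ _ _ _] := atlas_chart ad.
have oV : open (F @^-1` dom d) by apply: open_comp => // x _; exact: cF.
have [U [oU Uu] HU] := param_near ac oV cu dx.
exists U => //.
apply: (@smooth_on_eq _ _ _ _
  ((f \o param d) \o (fun u => coord d (F (param c u))))).
  by move=> y [cy Uy] /=; rewrite atlas_param //; exact: HU.
have sub : img c `&` U `<=` [set u | img c u /\ dom d (F (param c u))].
  by move=> y [cy Uy]; split=> //; exact: HU.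
apply: smooth_on_comp (smooth_on_sub sub (sF c d ac ad)) (sf d ad) _.
by move=> y /sub[cy dy]; exists (F (param c y)).
Qed.

Definition slice (t : R) m (u : 'rV[R]_m) : 'rV[R]_(1 + m) := row_mx t%:M u.

Lemma slice_l t m (u : 'rV[R]_m) : lsubmx (slice t u) 0 0 = t.
Proof. by rewrite row_mxKl mxE eqxx mulr1n. Qed.

Lemma slice_r t m (u : 'rV[R]_m) : rsubmx (slice t u) = u.
Proof. by rewrite row_mxKr. Qed.

Lemma slice_affine t m : exists L : {linear 'rV[R]_m -> 'rV[R]_(1 + m)},
  forall u, slice t u = slice t 0 + L u.
Proof.
have lin : linear (fun u : 'rV[R]_m => row_mx (0 : 'rV[R]_1) u).
  move=> a u v; rewrite scale_row_mx add_row_mx scaler0 addr0 //.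
pose LM := GRing.isLinear.Build _ _ _ _ _ lin.
pose L : {linear 'rV[R]_m -> 'rV[R]_(1 + m)} := HB.pack
  (fun u : 'rV[R]_m => row_mx (0 : 'rV[R]_1) u) LM.
exists L => u; rewrite /L /= /slice add_row_mx add0r addr0 //.
Qed.

Lemma slice_continuous t m : continuous (@slice t m).
Proof.
move=> u; apply/continuous_epsP => e e0; exists e => // v vu.
have -> : slice t v - slice t u = row_mx 0 (v - u).
  by rewrite /slice opp_row_mx add_row_mx subrr.
apply: le_lt_trans vu.
rewrite [leLHS]/Num.Def.normr /= mx_normrE; apply/bigmax_leP; split=> // -[i j] _ /=.
rewrite mxE; case: splitP => l _; first by rewrite mxE normr0.
by rewrite (ord1 i); exact: norm_coord_le.
Qed.

Lemma smooth_map_slice (F : R -> N -> M) (t : R) :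
  smooth_map_family F -> smooth_map (F t).
Proof.
move=> [cF sF]; split.
  move=> x; have cp : {for x, continuous (fun x : N => (t, x) : R * N)}.
    move=> A [[P Q] /= [Pt Qx] PQ]; apply: filterS Qx => y Qy.
    by apply: (PQ (t, y)); split=> //=; exact: nbhs_singleton Pt.
  exact: (@continuous_comp _ _ _ _ (fun p => F p.1 p.2) x cp (cF _)).
move=> c d ac ad; have [L LE] := slice_affine t n.
have := smooth_on_affine (@slice_continuous t n) LE (sF c d ac ad).
move=> H.
have E : (fun u => coord d (F t (param c u))) =
   (fun u : 'rV[R]_(1 + n) => coord d (F (lsubmx u 0 0) (param c (rsubmx u))))
     \o @slice t n by apply/funext => u /=; rewrite slice_l slice_r.
rewrite E; apply: smooth_on_sub H => u /= [cu du].
by rewrite /= slice_l slice_r.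
Qed.

End SmoothMapComp.

(** * Charts of a manifold without boundary, and tangent vectors *)

Lemma half_space_pos_ball (R : realType) n (y : 'rV[R]_n) :
  (forall i : 'I_n, val i = 0%N -> 0 < y 0 i) ->
  exists2 r : R, 0 < r & forall z : 'rV[R]_n, `|z - y| < r ->
    forall i : 'I_n, val i = 0%N -> 0 < z 0 i.
Proof.
move=> pos; have [[i i0]|H] := pselect (exists i : 'I_n, val i = 0%N); last first.
  by exists 1 => // z _ i i0; exfalso; apply: H; exists i.
exists (y 0 i); first exact: pos.
move=> z zy j j0; have -> : j = i by apply: val_inj; rewrite j0.
have := le_lt_trans (norm_coord_le (z - y) i) zy.
by rewrite !mxE ltr_norml => /andP[+ _]; lra.
Qed.

Section Boundaryless.
Variables (R : realType) (n : nat) (M : manifold R n).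
Hypothesis M_boundaryless : @boundary R n M = set0.

(** A point of the image on the wall of the half-space would be a boundary point
    of [M]. *)
Lemma open_img (c : chart R n M) : @atlas R n M c -> open (img c).
Proof.
move=> ac; have [_ [V oV cO] _ _ _] := atlas_chart ac.
rewrite openE => y cy; rewrite /interior.
have : (V `&` @half_space R n) y by rewrite -cO.
move=> [Vy hy].
have pos (i : 'I_n) : val i = 0%N -> 0 < y 0 i.
  move=> i0; rewrite lt_neqAle hy // andbT eq_sym; apply/eqP => yi.
  have [dy cK] := img_param ac cy.
  suff : (set0 : set M) (param c y) by [].
  by rewrite -M_boundaryless; exists c; split=> //; exists i; rewrite cK.
have [e e0 He] := open_norm_ball oV Vy.
have [r r0 Hr] := half_space_pos_ball pos.
apply/nbhs_ballP; exists (Num.min e r); first by rewrite /= lt_min e0.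
move=> z; rewrite -ball_normE /= distrC lt_min => /andP[ze zr].
by rewrite cO; split=> [|i i0]; [exact: He|exact/ltW/(Hr _ zr)].
Qed.

Lemma smooth_fun_Ck (c : chart R n M) (f : M -> R) k :
  @atlas R n M c -> smooth_fun f -> Ck (W := R^o) k (img c) (f \o param c).
Proof.
by move=> ac sf; apply: (smooth_on_Ck k (sf c ac)); [exact: open_img|].
Qed.

Definition extend0 (c : chart R n M) (g : 'rV[R]_n -> R) (x : M) : R :=
  if `[< dom c x >] then g (coord c x) else 0.

(** Outside of the chart the extension vanishes near each point, because the
    closed ball that carries [g] has a compact, hence closed, image in [M]. *)
Lemma smooth_extend0 (c : chart R n M) (g : 'rV[R]_n -> R) (y0 : 'rV[R]_n) (r : R) :
  @atlas R n M c -> 0 < r ->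
  (forall y, `|y - y0| <= r -> img c y) ->
  (forall k, Ck (W := R^o) k (img c) g) ->
  (forall y, g y != 0 -> `|y - y0| <= r) ->
  smooth_fun (extend0 c g).
Proof.
move=> ac r0 Br Cg sg d ad; apply: smooth_on_local => u du.
have [oc _ _ _ cparam] := atlas_chart ac.
have [cx|ncx] := pselect (dom c (param d u)).
  have [U [oU Uu] HU] := param_near ad oc du cx.
  exists U; first by [].
  have := atlas_compatible ad ac; rewrite /compatible => sm.
  have sub : img d `&` U `<=` coord d @` (dom d `&` dom c).
    move=> y [dy Uy]; have [dpy dK] := img_param ad dy.
    by exists (param d y) => //; split=> //; exact: HU.
  apply: (@smooth_on_eq _ _ _ _ (g \o (coord c \o param d))).
    move=> y [dy Uy] /=; rewrite /extend0 asboolT //; exact: HU.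
  apply: smooth_on_comp (smooth_on_sub sub sm) (Ck_smooth_on Cg (open_img ac) _) _.
    by move=> y; exact.
  by move=> y [dy Uy] /=; exists (param d y) => //; exact: HU.
pose K := [set y : 'rV[R]_n | `|y - y0| <= r].
have Kc : compact (param c @` K).
  apply: continuous_compact.
    by apply: continuous_subspaceW cparam => y; exact: Br.
  apply: bounded_closed_compact.
    exists (`|y0| + r); split=> [|B rB y Ky]; first exact: num_real.
    rewrite /= -[y](subrK y0) addrC (le_trans (ler_normD _ _)) //.
    by apply: le_trans (ltW rB); rewrite lerD2l.
  have -> : K = closed_ball y0 r; last exact: closed_ball_closed.
  by rewrite closed_ballE //; apply/seteqP; split=> y /=; rewrite /closed_ball_ /= distrC.
have oV : open (~` (param c @` K)).
  by apply: closed_openC; apply: compact_closed Kc; exact: manifold_hausdorff.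
have Vx : (~` (param c @` K)) (param d u).
  by move=> [y Ky yx]; apply: ncx; rewrite -yx; have [] := img_param ac (Br y Ky).
have [U [oU Uu] HU] := param_near ad oV du Vx.
exists U; first by [].
apply: (@smooth_on_eq _ _ _ _ (fun=> 0)); last exact: smooth_on_cst.
move=> y [dy Uy] /=; rewrite /extend0; case: asboolP => // cy.
apply/esym/eqP/negPn/negP => gy; apply: (HU y dy Uy).
by exists (coord c (param d y)); [exact: sg|exact: atlas_param].
Qed.

Lemma chart_ball (c : chart R n M) (x : M) (e : R) : @atlas R n M c -> dom c x -> 0 < e ->
  exists r : R, [/\ 0 < r, r <= e & forall y, `|y - coord c x| <= r -> img c y].
Proof.
move=> ac cx e0; have Ix : img c (coord c x) by exists x.
have [d d0 Hd] := open_norm_ball (open_img ac) Ix.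
exists (Num.min e (d / 2)); split; first by rewrite lt_min e0 divr_gt0.
  by rewrite ge_min lexx.
move=> y yx; apply: Hd; apply: le_lt_trans yx _.
by rewrite gt_min [X in _ || X]ltr_pdivrMr // ltr_pMr // ltr1n orbT.
Qed.

(** A bump function in a chart at [x], with a radius at most the distance of [y]
    to [x] in that chart. *)
Lemma separating_smooth_fun (x y : M) : x <> y ->
  exists f : M -> R, [/\ smooth_fun f, f x != 0 & f y = 0].
Proof.
move=> xy; have [c ac cx] := atlas_cover x.
have [e [e0 He]] : exists e : R, 0 < e /\ (dom c y -> e <= `|coord c y - coord c x|).
  have [cy|ncy] := pselect (dom c y); last by exists 1.
  exists `|coord c y - coord c x|; split=> //; rewrite normr_gt0 subr_eq0.
  apply/eqP => E; apply: xy.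
  by rewrite -(atlas_param ac cx) -E atlas_param.
have [r [r0 re Hr]] := chart_ball ac cx e0.
exists (extend0 c (bump (coord c x) r)); split.
- apply: (smooth_extend0 ac r0 Hr).
    by move=> k; apply: Ck_bump; exact: open_img.
  by move=> z /(bump_supp r0)/ltW.
- by rewrite /extend0 asboolT // gt_eqF // bump_gt0.
- rewrite /extend0; case: asboolP => // cy.
  apply/eqP/negPn/negP => /(bump_supp r0); rewrite ltNge.
  by rewrite (le_trans re) // He.
Qed.

End Boundaryless.

Section DirectionalTangent.
Variables (R : realType) (n : nat) (N : manifold R n).

Definition dirder (c : chart R n N) (x v : 'rV[R]_n) : tvec N := fun f =>
  if `[< smooth_fun f >] then 'D_v (f \o param c : _ -> R^o) x else 0.

Lemma dirderE c x v f : smooth_fun f ->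
  dirder c x v f = 'D_v (f \o param c : _ -> R^o) x.
Proof. by move=> sf; rewrite /dirder asboolT. Qed.

(** At an interior point of the image of the chart, a smooth function read in
    the chart is an honest C^k function; on the wall it would first have to be
    extended. *)
Lemma tangent_dirder c x v (U : set 'rV[R]_n) :
  @atlas R n N c -> open U -> U `<=` img c -> U x ->
  tangent (param c x) (dirder c x v).
Proof.
move=> ac oU Uc Ux.
have df f : smooth_fun f -> derivable (f \o param c : _ -> R^o) x v.
  by move=> sf; have [_ /(_ v)[+ _]] := smooth_on_Ck 1 (sf c ac) oU Uc; exact.
split.
- by move=> f nf; rewrite /dirder asboolF.
- move=> a f g sf sg; rewrite !dirderE //; last first.
    by apply: smooth_funD => //; exact: smooth_funZ.
  have -> : ((fun x => a * f x + g x) \o param c : _ -> R^o) =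
      a \*: (f \o param c : _ -> R^o) + (g \o param c : _ -> R^o) by [].
  by rewrite deriveD ?deriveZ //; [exact: df|exact: derivableZ (df _ sf)|exact: df].
- move=> f g sf sg; rewrite !dirderE //; last exact: smooth_funM.
  have -> : ((fun x => f x * g x) \o param c : _ -> R^o) =
      (f \o param c : _ -> R^o) * (g \o param c : _ -> R^o) by [].
  by rewrite deriveM; [rewrite [X in _ + X]mulrC|exact: df|exact: df].
Qed.

End DirectionalTangent.

Section Push.
Variables (R : realType) (n : nat) (S M : manifold R n) (phi : S -> M).
Hypothesis smphi : smooth_map phi.

Lemma pushE u f : smooth_fun f -> push phi u f = u (f \o phi).
Proof. by move=> sf; rewrite /push asboolT. Qed.

Lemma tangent_push s u : tangent s u -> tangent (phi s) (push phi u).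
Proof.
move=> [u0 ul um]; split.
- by move=> f nf; rewrite /push asboolF.
- move=> a f g sf sg; rewrite !pushE //; last first.
    by apply: smooth_funD => //; exact: smooth_funZ.
  by apply: (ul a (f \o phi) (g \o phi)); exact: smooth_fun_comp.
- move=> f g sf sg; rewrite !pushE //; last exact: smooth_funM.
  by apply: (um (f \o phi) (g \o phi)); exact: smooth_fun_comp.
Qed.

Lemma push_comp (K : manifold R n) (eta : M -> K) u : smooth_map eta ->
  push eta (push phi u) = push (eta \o phi) u.
Proof.
move=> seta; apply/funext => f; rewrite /push.
case: asboolP => // sf; rewrite asboolT //; exact: smooth_fun_comp.
Qed.

Hypothesis M_boundaryless : @boundary R n M = set0.

(** This puts [push phi (dirder c x v)] in the form that
    [vector_field_extension] can extend to a vector field on [M]. *)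
Lemma push_dirder (c : chart R n S) (d : chart R n M) x v (U : set 'rV[R]_n) :
  @atlas R n S c -> @atlas R n M d -> open U -> U `<=` img c -> U x ->
  dom d (phi (param c x)) ->
  exists w, push phi (dirder c x v) = dirder d (coord d (phi (param c x))) w.
Proof.
move=> ac ad oU Uc Ux dx.
pose Phi u := coord d (phi (param c u)).
have [od _ _ _ _] := atlas_chart ad.
have oV : open (phi @^-1` dom d).
  by apply: open_comp => // y _; exact: smphi.1.
have [V [oV' Vx] HV] := param_near ac oV (Uc _ Ux) dx.
have oUV := openI oU oV'.
have sub : U `&` V `<=` [set u | img c u /\ dom d (phi (param c u))].
  by move=> y [Uy Vy]; split; [exact: Uc|apply: HV => //; exact: Uc].
have CPhi : Ck 1 (U `&` V) Phi.
  exact: (smooth_on_Ck 1 (smphi.2 c d ac ad) oUV sub).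
have dPhi : derivable Phi x v by exact: (CPhi.2 v).1.
exists ('D_v Phi x); apply/funext => f; rewrite /push.
case: asboolP => sf; last by rewrite /dirder asboolF.
rewrite !dirderE //; last exact: smooth_fun_comp.
have Cf := smooth_fun_Ck M_boundaryless 1 ad sf.
have Ix : img d (Phi x) by exists (phi (param c x)).
have dff : differentiable (f \o param d : _ -> R^o) (Phi x).
  apply: (@C1_differentiable _ _ (img d)) => //.
  - exact: open_img.
  - by move=> y w; exact: (Cf.2 w).1.
  - by move=> y w; exact: (Cf.2 w).2.1.
have [_ <-] := is_derive_chain dPhi dff.
apply: near_eq_derive; apply: filterS (near_open oUV (conj Ux Vx)) => y /sub[_ dy] /=.
by rewrite /Phi atlas_param.
Qed.

End Push.

Section ExtendTangent.
Variables (R : realType) (n : nat) (M : manifold R n).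
Hypothesis M_boundaryless : @boundary R n M = set0.

(** The constant field [w] of the chart, multiplied by a bump function
    normalized to [1] at [p]. *)
Lemma vector_field_extension (c : chart R n M) (p : M) (w : 'rV[R]_n) :
  @atlas R n M c -> dom c p ->
  exists2 X : M -> tvec M, vector_field X & X p = dirder c (coord c p) w.
Proof.
move=> ac cp; have [r [r0 _ Hr]] := chart_ball M_boundaryless ac cp ltr01.
set y0 := coord c p; pose b := bump y0 r.
pose X x : tvec M := fun f =>
  if `[< dom c x >] then (b (coord c x) / b y0) * dirder c (coord c x) w f else 0.
have oc := open_img M_boundaryless ac.
exists X; last first.
  by apply/funext => f; rewrite /X asboolT // divff ?mul1r // gt_eqF // bump_gt0.
split=> [x|f sf].
  rewrite /X; case: asboolP => [cx|_]; last first.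
    by split=> // *; rewrite !(mulr0, mul0r, addr0).
  have Ix : img c (coord c x) by exists x.
  have [D0 Dl Dm] := tangent_dirder w ac oc (@subset_refl _ _) Ix.
  rewrite atlas_param // in D0 Dl Dm.
  split.
  - by move=> f /D0 ->; rewrite mulr0.
  - by move=> a f g sf sg; rewrite Dl // mulrDr mulrCA.
  - by move=> f g sf sg; rewrite Dm // mulrDr mulrCA !mulrA.
pose g y := b y / b y0 * 'D_w (f \o param c : _ -> R^o) y.
have -> : (fun x => X x f) = extend0 c g.
  by apply/funext => x; rewrite /X /extend0 dirderE.
apply: (smooth_extend0 M_boundaryless ac r0 Hr).
  move=> k; apply: Ck_mul => //.
    apply: Ck_mul => //; last exact: Ck_cst.
    exact: Ck_bump.
  exact: ((smooth_fun_Ck M_boundaryless k.+1 ac sf).2 w).2.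
move=> y gy; apply: ltW; apply: (bump_supp r0); apply: contra gy => /eqP by0.
by rewrite /g /b by0 !mul0r.
Qed.

End ExtendTangent.

(** * Locally constant functions *)

Section LocallyConstant.
Variable R : realType.

Definition locally_constant (T : topologicalType) (g : T -> R) : Prop :=
  forall x, \forall y \near x, g y = g x.

(** The equivalence relation whose classes are the quasi-components. *)
Definition linked (T : topologicalType) (p q : T) : Prop :=
  forall g : T -> R, locally_constant g -> g p = g q.

(** The function [k \o gam] has zero derivative, so the mean value theorem
    applies; this is connectedness of the segment in a form that accepts a
    hypothesis on [k] along the arc only. *)
Lemma constant_along_arc (T : topologicalType) (k : T -> R) (gam : R -> T) (a b : R) :
  a <= b -> {within `[a, b], continuous gam} ->
  (forall s, a <= s <= b -> \forall y \near gam s, k y = k (gam s)) ->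
  k (gam a) = k (gam b).
Proof.
move=> ab cg kg.
have cont : {within `[a, b], continuous (k \o gam)}.
  apply/subspace_continuousP => s sab; move/subspace_continuousP: cg => /(_ s sab) cg.
  have sab' : a <= s <= b by move: sab; rewrite /= in_itv.
  move=> A As; have H : nbhs (gam s) (k @^-1` A).
    by apply: filterS (kg s sab') => y ky; rewrite /preimage /= ky; exact: nbhs_singleton As.
  exact: (cg _ H).
have [|c] := @MVT_segment R (k \o gam) (fun=> 0) a b ab _ cont.
  move=> s; rewrite in_itv /= => /andP[sa sb].
  apply: (@near_eq_is_derive R R^o R^o (cst (k (gam s)))).
  have sab : a <= s <= b by rewrite !ltW.
  have sab' : `[a, b]%classic s by rewrite /= in_itv.
  move/subspace_continuousP: cg => /(_ s sab') cg.
  have H : nbhs s [set y | `[a, b]%classic y -> k (gam y) = k (gam s)].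
    by apply: (cg [set y | k y = k (gam s)]); exact: kg.
  have J : nbhs s `[a, b]%classic.
    have sin : s \in `]a, b[ by rewrite in_itv /= sa.
    apply: filterS (near_in_itvoo sin) => y.
    by rewrite /= !in_itv /= => /andP[ya yb]; rewrite !ltW.
  by apply: filterS2 H J => y Hy /Hy /= ->.
by rewrite mul0r => _ /eqP; rewrite subr_eq0 => /eqP /= ->.
Qed.

Lemma linked_arc (T : topologicalType) (gam : R -> T) (a b : R) :
  a <= b -> {within `[a, b], continuous gam} -> linked (gam a) (gam b).
Proof.
by move=> ab cg g lg; apply: (constant_along_arc ab cg) => s _; exact: lg.
Qed.

Lemma linked_sym (T : topologicalType) (p q : T) : linked p q -> linked q p.
Proof. by move=> H g /H. Qed.

Lemma linked_trans (T : topologicalType) (p q r : T) :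
  linked p q -> linked q r -> linked p r.
Proof. by move=> H K g lg; rewrite (H g lg) (K g lg). Qed.

End LocallyConstant.

Section Manifold.
Variables (R : realType) (n : nat) (S : manifold R n).

Lemma half_space_chart (c : chart R n S) y : @atlas R n S c -> img c y ->
  @half_space R n y /\ exists2 e : R, 0 < e &
    forall z, @half_space R n z -> `|z - y| < e -> img c z.
Proof.
move=> ac cy; have [_ [V oV cE] _ _ _] := atlas_chart ac.
have : (V `&` @half_space R n) y by rewrite -cE.
move=> [Vy hy]; split=> //; have [e e0 He] := open_norm_ball oV Vy.
by exists e => // z hz zy; rewrite cE; split=> //; exact: He.
Qed.

Lemma convex_ball (y a b : 'rV[R]_n) (e s : R) : 0 <= s <= 1 ->
  `|a - y| < e -> `|b - y| < e -> `|a + s *: (b - a) - y| < e.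
Proof.
move=> /andP[s0 s1] ay be.
have -> : a + s *: (b - a) - y = (1 - s) *: (a - y) + s *: (b - y).
  by apply/rowP => i; rewrite !mxE; ring.
apply: le_lt_trans (ler_normD _ _) _; rewrite !normrZ (ger0_norm s0).
rewrite ger0_norm ?subr_ge0 //.
have [->|sn0] := eqVneq s 0; first by rewrite subr0 mul1r mul0r addr0.
have sp : 0 < s by rewrite lt_neqAle eq_sym sn0.
have H1 : (1 - s) * `|a - y| <= (1 - s) * e by apply: ler_wpM2l; [rewrite subr_ge0|exact: ltW].
have H2 : s * `|b - y| < s * e by rewrite ltr_pM2l.
by apply: lt_le_trans (ler_ltD H1 H2) _; rewrite -mulrDl subrK mul1r.
Qed.

(** On small convex sets of interior points the mean value theorem applies.
    Points of the wall are limits of interior points along the inner normal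
    [e1]. *)
Lemma zero_dirder_locally_constant (g : S -> R) : smooth_fun g ->
  (forall c x v (U : set 'rV[R]_n), @atlas R n S c -> open U -> U `<=` img c ->
     U x -> dirder c x v g = 0) ->
  locally_constant g.
Proof.
move=> sg dg x; have [c ac cx] := atlas_cover x.
set y0 := coord c x; have Iy0 : img c y0 by exists x.
have [hy0 [e e0 He]] := half_space_chart ac Iy0.
pose h : 'rV[R]_n -> R^o := g \o param c.
pose e1 : 'rV[R]_n := \row_i (val i == 0%N)%:R.
pose I := [set z : 'rV[R]_n | `|z - y0| < e /\
  forall i : 'I_n, val i = 0%N -> 0 < z 0 i].
have oI : open I.
  rewrite openE => z [zy zp]; rewrite /interior.
  have [r r0 Hr] := half_space_pos_ball zp.
  apply/nbhs_ballP; exists (Num.min r (e - `|z - y0|)).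
    by rewrite /= lt_min r0 subr_gt0.
  move=> w; rewrite -ball_normE /= distrC lt_min => /andP[wr we].
  split; last exact: Hr.
  have -> : w - y0 = (w - z) + (z - y0) by rewrite addrA subrK.
  by apply: le_lt_trans (ler_normD _ _) _; rewrite -ltrBrDr.
have Ic : I `<=` img c by move=> z [zy zp]; apply: He => // i i0; exact/ltW/zp.
have h_eq a b : I a -> I b -> h a = h b.
  move=> Ia Ib.
  have Iab s : 0 <= s <= 1 -> I (a + s *: (b - a)).
    move=> s01; split; first by apply: convex_ball => //; [exact: Ia.1|exact: Ib.1].
    move=> i i0; have := Ia.2 i i0; have := Ib.2 i i0; rewrite !mxE.
    set u := a 0 i; set v := b 0 i => v0 u0; case/andP: s01 => s0 s1.
    have -> : u + s * (v - u) = (1 - s) * u + s * v by ring.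
    have [->|sn0] := eqVneq s 0; first by rewrite subr0 mul1r mul0r addr0.
    by rewrite ltr_wpDl ?mulr_ge0 ?subr_ge0 ?(ltW u0) // mulr_gt0 // lt_neqAle eq_sym sn0.
  have dh z v : I z -> derivable h z v.
    by move=> Iz; have [_ /(_ v)[+ _]] := smooth_on_Ck 1 (sg c ac) oI Ic; exact.
  have [s s01] := @mean_value_line R n h a (b - a) (fun s s01 => dh _ _ (Iab s s01)).
  rewrite [X in h X](addrC a) subrK => E; apply/esym/eqP.
  rewrite -subr_eq0 E; apply/eqP.
  by rewrite -(dirderE c _ _ sg); exact: dg ac oI Ic (Iab s s01).
have near_h z : @half_space R n z -> `|z - y0| < e -> forall d, 0 < d ->
    exists2 t0 : R, 0 < t0 & forall t, 0 < t < t0 ->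
      I (z + t *: e1) /\ `|h (z + t *: e1) - h z| < d.
  move=> hz zy d d0; have cz : img c z by exact: He.
  have [U [gg [oU Uz Cgg ggE]]] := sg c ac z cz.
  have [d1 d10 Hd1] := (continuous_epsP _ _).1 (Ck_continuous (Cgg 0%N) Uz) d d0.
  have [d2 d20 Hd2] := open_norm_ball oU Uz.
  have ne1 t : 0 < t -> `|z + t *: e1 - z| <= t.
    move=> t0; rewrite addrAC subrr add0r normrZ gtr0_norm //.
    apply: ler_piMr; first exact: ltW.
    rewrite /Num.Def.normr /= mx_normrE; apply/bigmax_leP; split=> // -[i j] _ /=.
    by rewrite mxE; case: (_ == _); rewrite ?normr1 ?normr0.
  exists (Num.min (Num.min d1 d2) (e - `|z - y0|)).
    by rewrite !lt_min d10 d20 subr_gt0.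
  move=> t; rewrite !lt_min => /andP[t0 /andP[/andP[td1 td2] te]].
  have It : I (z + t *: e1).
    split.
      have -> : z + t *: e1 - y0 = (z + t *: e1 - z) + (z - y0) by rewrite addrA subrK.
      apply: le_lt_trans (ler_normD _ _) _; rewrite -ltrBrDr.
      exact: le_lt_trans (ne1 t t0) te.
    by move=> i i0; rewrite !mxE i0 eqxx mulr1 ltr_wpDl // hz.
  have E1 : gg z = h z := ggE z cz Uz.
  have E2 : gg (z + t *: e1) = h (z + t *: e1).
    by apply: ggE; [exact: Ic|apply: Hd2; exact: le_lt_trans (ne1 t t0) td2].
  by split=> //; rewrite -E1 -E2; apply: Hd1; exact: le_lt_trans (ne1 t t0) td1.
have hE z : @half_space R n z -> `|z - y0| < e -> h z = h y0.
  move=> hz zy; apply/eqP; rewrite -subr_eq0 -normr_le0.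
  apply/ler_addgt0Pl => d d0; rewrite addr0.
  have d20 : 0 < d / 2 by rewrite divr_gt0.
  have [t1 t10 Ht1] := near_h z hz zy _ d20.
  have y0y0 : `|y0 - y0| < e by rewrite subrr normr0.
  have [t2 t20 Ht2] := near_h y0 hy0 y0y0 _ d20.
  pose t := Num.min t1 t2 / 2.
  have m0 : 0 < Num.min t1 t2 by rewrite lt_min t10.
  have tm : t < Num.min t1 t2 by rewrite /t ltr_pdivrMr // ltr_pMr // ltr1n.
  have t0 : 0 < t by rewrite divr_gt0.
  have [I1 N1] : I (z + t *: e1) /\ `|h (z + t *: e1) - h z| < d / 2.
    by apply: Ht1; rewrite t0 /=; move: tm; rewrite lt_min => /andP[].
  have [I2 N2] : I (y0 + t *: e1) /\ `|h (y0 + t *: e1) - h y0| < d / 2.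
    by apply: Ht2; rewrite t0 /=; move: tm; rewrite lt_min => /andP[].
  rewrite (h_eq _ _ I1 I2) distrC in N1.
  by apply: ltW; apply: le_lt_trans (ler_distD _ _ _) _; rewrite (splitr d); exact: ltrD N1 N2.
have [od _ _ cc _] := atlas_chart ac.
have oB : open [set y : 'rV[R]_n | `|y - y0| < e].
  have -> : [set y : 'rV[R]_n | `|y - y0| < e] = ball y0 e; last exact: ball_open.
  by apply/seteqP; split=> y; rewrite -ball_normE /= distrC.
have By0 : [set y : 'rV[R]_n | `|y - y0| < e] (coord c x).
  by rewrite /= subrr normr0.
have [U [oU Ux] HU] := within_continuous_open cc oB cx By0.
apply: filterS (near_open (openI oU od) (conj Ux cx)) => y [Uy dy].
have Iy : img c (coord c y) by exists y.
have [hy _] := half_space_chart ac Iy.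
have := hE _ hy (HU _ dy Uy).
by rewrite /h /= /y0 !atlas_param.
Qed.

Lemma img_line_continuous (c : chart R n S) (y w : 'rV[R]_n) (I : set R) :
  @atlas R n S c -> (forall s, I s -> img c (y + s *: w)) ->
  {within I, continuous (fun s => param c (y + s *: w))}.
Proof.
move=> ac Iw; apply/subspace_continuousP => s Is A; rewrite nbhsE => -[V [oV Vs] VA].
have [U [oU Us] HU] := param_near ac oV (Iw s Is) Vs.
have cl : {for s, continuous (fun s : R => y + s *: w)}.
  apply: (@continuousD _ _ _ (fun=> y) (fun s : R => s *: w)); first exact: cst_continuous.
  exact: scalel_continuous.
have : nbhs s ((fun s : R => y + s *: w) @^-1` U) by apply: cl; exact: (near_open oU Us).
by apply: filterS => r Ur Ir; apply: VA; apply: HU => //; exact: Iw.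
Qed.

(** Move inside the wall [x_0 = 0] of a chart, along the coordinate of index 1. *)
Lemma linked_boundary_points_dim_ge2 (p : S) : (2 <= n)%N -> boundary p ->
  exists q, [/\ boundary q, p <> q & linked R p q].
Proof.
move=> n2 [c [ac cp [i [i0 pi]]]].
have Ip : img c (coord c p) by exists p.
set y := coord c p in pi Ip *.
have [hy [e e0 He]] := half_space_chart ac Ip.
pose j : 'I_n := Ordinal n2; have ij : i != j by apply/eqP => E; move: i0; rewrite E.
pose w : 'rV[R]_n := delta_mx 0 j.
have Iw s : 0 <= s <= e / 2 -> img c (y + s *: w).
  move=> /andP[s0 se]; apply: He.
    move=> k k0; rewrite !mxE eqxx /= (_ : k = i); last by apply: val_inj; rewrite k0.
    by rewrite (negPf ij) mulr0 addr0 pi.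
  rewrite addrAC subrr add0r normrZ ger0_norm //.
  apply: (@le_lt_trans _ _ (s * 1)).
    rewrite ler_wpM2l // /Num.Def.normr /= mx_normrE; apply/bigmax_leP; split=> // -[a b] _ /=.
    by rewrite mxE; case: (_ && _); rewrite ?normr1 ?normr0.
  by rewrite mulr1 (le_lt_trans se) // ltr_pdivrMr // ltr_pMr // ltr1n.
have e20 : 0 <= e / 2 by rewrite divr_ge0 // ltW.
have Iq := Iw (e / 2); rewrite lexx e20 in Iq; have {Iq} Iq := Iq isT.
have [dq qK] := img_param ac Iq.
exists (param c (y + (e / 2) *: w)); split.
- exists c; split=> //; exists i; split=> //.
  by rewrite qK !mxE (negPf ij) andbF mulr0 addr0 pi.
- move=> pq; have := congr1 (fun x => coord c x 0 j) pq.
  rewrite qK -/y !mxE !eqxx mulr1 => E.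
  have : 0 < e / 2 by rewrite divr_gt0.
  lra.
- have cl := @img_line_continuous c y w `[0, e / 2]%classic ac _.
  have := linked_arc e20 (cl _).
  rewrite scale0r addr0 atlas_param //; apply => s.
  by rewrite /= in_itv /=; exact: Iw.
Qed.

End Manifold.

(** * The second end of a one-dimensional component *)

Section Arcs.
Variables (R : realType) (T : topologicalType).
Hypotheses (T_hausdorff : hausdorff_space T) (T_compact : compact [set: T]).
Variables (p : T) (C : set T).
Hypothesis C_closed : closed C.
Hypothesis C_arc : forall (gam : R -> T) (a b : R),
  a <= b -> {within `[a, b], continuous gam} -> C (gam a) <-> C (gam b).

(** A homeomorphism from the interval (-1, 1) onto an open neighbourhood of [y]. *)
Definition arc_at (y : T) (gam : R -> T) : Prop :=
  [/\ gam 0 = y,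
      forall t, -1 < t < 1 -> {for t, continuous gam},
      forall s t, -1 < s < 1 -> -1 < t < 1 -> gam s = gam t -> s = t &
      forall u v, -1 <= u -> v <= 1 -> open (gam @` [set t | u < t < v])].

(** A homeomorphism from the interval [0, 1) onto an open neighbourhood of the
    end point [y]. *)
Definition half_arc_at (y : T) (gam : R -> T) : Prop :=
  [/\ gam 0 = y,
      {within `[0, 1[, continuous gam},
      forall s t, 0 <= s < 1 -> 0 <= t < 1 -> gam s = gam t -> s = t &
      forall v, v <= 1 -> open (gam @` [set t | 0 <= t < v])].

(** [P] stands for a piece of curve that starts at [p], and [z] is the only
    point through which the curve leaves [P]. The last condition says that [P]
    arrives at [z] from one side only, which rules out that the curve closes up
    at [z]. *)
Definition front (P : set T) (z : T) : Prop :=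
  [/\ open P /\ P p, P `<=` C, closure P `<=` P `|` [set z],
      ~ P z /\ closure P z & ~ nbhs z (closure P)].

Lemma arc_within y gam a b : arc_at y gam -> -1 < a -> b < 1 ->
  {within `[a, b], continuous gam}.
Proof.
move=> [_ cg _ _] a1 b1; apply: continuous_in_subspaceT => t.
rewrite inE /= in_itv /= => /andP[at_ tb]; apply: cg.
by rewrite (lt_le_trans a1 at_) (le_lt_trans tb b1).
Qed.

Lemma arc_flip y gam : arc_at y gam -> arc_at y (gam \o -%R).
Proof.
move=> [g0 cg ig og]; split.
- by rewrite /= oppr0.
- move=> t t1; apply: continuous_comp; first exact: opp_continuous.
  by apply: cg; rewrite ltrNl opprK ltrNl andbC.
- move=> s t s1 t1 /= E; apply: oppr_inj; apply: ig E.
    by rewrite ltrNl opprK ltrNl andbC.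
  by rewrite ltrNl opprK ltrNl andbC.
- move=> u v u1 v1.
  have -> : (gam \o -%R) @` [set t | u < t < v] = gam @` [set t | - v < t < - u].
    apply/seteqP; split=> x [t /= tuv <-].
      by exists (- t) => //=; rewrite !ltrN2 andbC.
    by exists (- t); rewrite /= ?opprK // ltrNr ltrNl andbC.
  by apply: og; rewrite ?lerN2 // lerNl.
Qed.

Lemma arc_closed y gam a b : arc_at y gam -> -1 < a -> b < 1 ->
  closed (gam @` `[a, b]%classic).
Proof.
move=> ag a1 b1; apply: compact_closed => //.
by apply: continuous_compact; [exact: arc_within ag a1 b1|exact: segment_compact].
Qed.

Lemma arc_right y gam t (W : set T) b : arc_at y gam -> -1 < t < 1 -> t < b ->
  nbhs (gam t) W -> exists2 s, t < s < b & W (gam s).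
Proof.
move=> [_ cg _ _] t1 tb /(cg t t1) /nbhs_ballP[e /= e0 He].
pose d := Num.min e (b - t) / 2.
have m0 : 0 < Num.min e (b - t) by rewrite lt_min e0 subr_gt0.
have dm : d < Num.min e (b - t) by rewrite /d ltr_pdivrMr // ltr_pMr // ltr1n.
have d0 : 0 < d by rewrite divr_gt0.
move: dm; rewrite lt_min => /andP[de db].
exists (t + d); first by rewrite ltrDl d0 /= -ltrBrDl.
by apply: He; rewrite /ball /= opprD addrA subrr add0r normrN gtr0_norm.
Qed.

Lemma arc_left y gam t (W : set T) a : arc_at y gam -> -1 < t < 1 -> a < t ->
  nbhs (gam t) W -> exists2 s, a < s < t & W (gam s).
Proof.
move=> ag t1 at_ Wt; have t1' : -1 < - t < 1 by rewrite ltrNl opprK ltrNl andbC.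
have [||s /andP[s1 s2] Ws] := @arc_right _ _ (- t) W (- a) (arc_flip ag) t1' _ _.
- by rewrite ltrN2.
- by rewrite /= opprK.
by exists (- s) => //; rewrite ltrNr s2 ltrNl.
Qed.

Lemma arc_C y gam a b : arc_at y gam -> -1 < a < 1 -> -1 < b < 1 ->
  C (gam a) -> C (gam b).
Proof.
move=> ag /andP[a1 a2] /andP[b1 b2]; case: (leP a b) => ab.
  exact: (C_arc ab (arc_within ag a1 b2)).1.
exact: (C_arc (ltW ab) (arc_within ag b1 a2)).2.
Qed.

(** Away from [z], membership in [P] is locally constant. *)
Lemma front_side P z (gam : R -> T) (a b : R) : front P z -> a <= b ->
  {within `[a, b], continuous gam} -> (forall s, a <= s <= b -> gam s <> z) ->
  P (gam a) <-> P (gam b).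
Proof.
move=> [[oP Pp] PC cP [nPz cPz] nz] ab cg nsz.
pose k x : R := (`[< P x >] : bool)%:R.
suff E : k (gam a) = k (gam b).
  move: E; rewrite /k; case: asboolP => Pa; case: asboolP => Pb //.
    by move/eqP; rewrite oner_eq0.
  by move/eqP; rewrite eq_sym oner_eq0.
apply: (constant_along_arc ab cg) => s sab.
have [Ps|nPs] := pselect (P (gam s)).
  by apply: filterS (near_open oP Ps) => y Py; rewrite /k !asboolT.
have : ~ closure P (gam s) by move=> /cP [//|/= E]; exact: (nsz s sab).
move=> /existsNP [B /not_implyP [Bs nB]].
apply: filterS Bs => y By; rewrite /k !asboolF // => Py.
by apply: nB; exists y.
Qed.

Lemma front_side_arc P z y gam a b : front P z -> arc_at y gam ->
  -1 < a < 1 -> -1 < b < 1 ->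
  (forall s, Num.min a b <= s <= Num.max a b -> gam s <> z) ->
  P (gam a) -> P (gam b).
Proof.
move=> fP ag /andP[a1 a2] /andP[b1 b2]; case: (leP a b) => ab H.
  exact: (front_side fP ab (arc_within ag a1 b2) H).1.
exact: (front_side fP (ltW ab) (arc_within ag b1 a2) H).2.
Qed.

(** By [front_side] an arc can only leave [P] at [z]. If [P] contained points of
    the arc on both sides of [z], then its closure would be a neighbourhood of
    [z]. *)
Lemma front_cut P z y gam t0 t1 : front P z -> arc_at y gam ->
  -1 < t0 -> t0 < t1 -> t1 < 1 -> P (gam t0) -> ~ P (gam t1) ->
  exists tau, [/\ t0 < tau <= t1, gam tau = z,
    forall t, -1 < t < tau -> P (gam t) & forall t, tau <= t < 1 -> ~ P (gam t)].
Proof.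
move=> fP ag t0l t01 t1r Pt0 nPt1; have [g0 cg ig og] := ag.
have t0b : -1 < t0 < 1 by rewrite t0l (lt_trans t01 t1r).
have t1b : -1 < t1 < 1 by rewrite (lt_trans t0l t01) t1r.
have [tau /andP[tau0 tau1] tauz] : exists2 tau, t0 <= tau <= t1 & gam tau = z.
  apply: contrapT => H; apply: nPt1.
  apply: (front_side_arc fP ag t0b t1b _ Pt0) => s.
  rewrite (min_idPl (ltW t01)) (max_idPr (ltW t01)) => st sz.
  by apply: H; exists s.
have taub : -1 < tau < 1 by rewrite (lt_le_trans t0l tau0) (le_lt_trans tau1 t1r).
have [[oP Pp] PC cP [nPz cPz] nz] := fP.
have tau0' : t0 < tau.
  rewrite lt_neqAle tau0 andbT; apply/eqP => E; apply: nPz.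
  by rewrite -tauz -E.
have avoid (s t : R) : -1 < s < 1 -> -1 < t < 1 -> P (gam s) ->
    (s < tau /\ t < tau) \/ (tau < s /\ tau < t) -> P (gam t).
  move=> sb tb Ps st; apply: (front_side_arc fP ag sb tb _ Ps) => r /andP[r1 r2] rz.
  have rb : -1 < r < 1.
    move: sb tb r1 r2 => /andP[s1 s2] /andP[t1' t2].
    rewrite ge_min le_max => /orP[r1|r1] /orP[r2|r2];
    by rewrite ?(lt_le_trans _ r1) ?(le_lt_trans r2) // ?andbT.
  have E : r = tau by apply: ig => //; rewrite rz.
  move: r1 r2; rewrite E ge_min le_max.
  by case: st => -[s1 t1']; rewrite !leNgt s1 t1'.
have left (t : R) : -1 < t < tau -> P (gam t).
  move=> /andP[tl tt]; apply: (avoid t0) => //; last by left.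
  by rewrite tl (lt_trans tt) //; case/andP: taub.
exists tau; split=> //; first by rewrite tau0'.
move=> t /andP[]; rewrite le_eqVlt => /orP[/eqP <- _|tt tr]; first by rewrite tauz.
move=> Pt; apply: nz.
have Jz : nbhs z (gam @` [set t | -1 < t < 1]).
  by apply: near_open; [exact: og|exists tau].
apply: filterS Jz => x [s sb <-]; have [sl sr] := andP sb.
have [st|st|->] := ltgtP s tau; last by rewrite tauz.
  by apply: subset_closure; apply: left; rewrite sl.
apply: subset_closure; apply: (avoid t) => //; last by right.
by rewrite tr (lt_trans _ tt) //; case/andP: taub.
Qed.

(** By [front_cut], exactly one side of [z] on the arc belongs to [P]. Adding
    half of the other side moves the front to [gam 2^-1]. *)
Lemma front_extend P z gam : front P z -> arc_at z gam ->
  exists P' z', [/\ front P' z', P `<=` P' & P' z].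
Proof.
move=> fP; wlog [t0 /andP[t0l t0r] Pt0] : gam /
    exists2 t0 : R, -1 < t0 < 0 & P (gam t0).
  move=> H ag; have [g0 cg ig og] := ag.
  have [[oP Pp] PC cP [nPz cPz] nz] := fP.
  have Jz : nbhs z (gam @` [set t | -1 < t < 1]).
    apply: near_open; first exact: og.
    by exists 0 => //=; rewrite ltrN10 ltr01.
  have [x [Px [t /= /andP[tl tr] tx]]] := cPz _ Jz.
  have [t0|t0|t0] := ltgtP t 0.
  - by apply: (H gam _ ag); exists t; rewrite ?tl // tx.
  - apply: (H _ _ (arc_flip ag)); exists (- t); last by rewrite /= opprK tx.
    by rewrite ltrNl opprK tr ltrNl oppr0.
  - by exfalso; apply: nPz; rewrite -g0 -t0 tx.
move=> ag; have [g0 cg ig og] := ag.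
have [[oP Pp] PC cP [nPz cPz] nz] := fP.
have nPg0 : ~ P (gam 0) by rewrite g0.
have [tau [/andP[tau1 tau2] tauz left right]] :=
  front_cut fP ag t0l t0r ltr01 Pt0 nPg0.
have tau0 : tau = 0.
  apply: ig; rewrite ?ltrN10 ?ltr01 ?tauz ?g0 //.
  by rewrite (lt_trans t0l tau1) (le_lt_trans tau2 ltr01).
rewrite {tau tau1 tau2 tauz}tau0 in left right.
have h0 : 0 < (2^-1 : R) by rewrite invr_gt0.
have h1 : (2^-1 : R) < 1 by rewrite invf_lt1 // ltr1n.
have hb : -1 < (2^-1 : R) < 1 by rewrite h1 (lt_trans _ h0) // ltrN10.
have nh1 : -1 < - (2^-1 : R) by rewrite ltrN2.
pose B := gam @` [set t | - 2^-1 < t < 2^-1].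
have Bb (t : R) : - 2^-1 < t < 2^-1 -> -1 < t < 1.
  by move=> /andP[a b]; rewrite (lt_trans nh1 a) (lt_trans b h1).
have oB : open B by apply: og; rewrite ltW.
have clB : closure B `<=` gam @` `[- 2^-1, 2^-1]%classic.
  rewrite [X in _ `<=` X]((closure_id _).1 _); last exact: arc_closed ag nh1 h1.
  apply: closure_subset => x [t /= /andP[a b] <-]; exists t => //=.
  by rewrite in_itv /= !ltW.
have Pnh : P (gam (- 2^-1)) by apply: left; rewrite nh1 oppr_lt0.
have clP' : closure (P `|` B) `<=` (P `|` B) `|` [set gam 2^-1].
  rewrite closureU => x [/cP[Px|/= ->]|/clB[t /= tb <-]].
  - by left; left.
  - by left; right; exists 0; rewrite //= oppr_lt0 h0.
  - move: tb; rewrite in_itv /= => /andP[].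
    rewrite le_eqVlt => /orP[/eqP <- _|tl]; first by left; left.
    rewrite le_eqVlt => /orP[/eqP ->|tr]; first by right.
    by left; right; exists t => //=; rewrite tl.
have nB (s : R) : 2^-1 <= s < 1 -> ~ B (gam s).
  move=> /andP[s1 s2] [t /= tb] /ig E; move: (tb); rewrite E.
  - by rewrite [X in _ && X]ltNge s1 andbF.
  - exact: Bb.
  - by rewrite s2 (lt_le_trans _ s1) //; case/andP: hb.
exists (P `|` B), (gam 2^-1); split; last first.
- by right; exists 0; rewrite //= oppr_lt0 h0.
- by move=> x; left.
split.
- by split; [exact: openU|left].
- move=> x [/PC //|[t tb <-]]; apply: (arc_C ag _ (Bb _ tb) (PC _ Pnh)).
  by rewrite nh1 (lt_trans _ h1) // (lt_trans _ h0) // oppr_lt0.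
- exact: clP'.
- split=> [[|]|W Wz].
  + by apply: right; rewrite ltW.
  + by apply: nB; rewrite lexx h1.
  + have nhh : - 2^-1 < (2^-1 : R) by rewrite (lt_trans _ h0) // oppr_lt0.
    have [s sb Ws] := arc_left ag hb nhh Wz.
    by exists (gam s); split=> //; right; exists s.
- move=> nb; have [s sb /clP'] := arc_right ag hb h1 nb.
  have [s1 s2] := andP sb.
  move=> [[|]|/= /ig E].
  + by apply: right; rewrite s2 andbT ltW // (lt_trans h0).
  + by apply: nB; rewrite s2 andbT ltW.
  + have : s = 2^-1 by apply: E; rewrite ?s2 ?(lt_trans _ s1) //; case/andP: hb.
    by move=> Es; rewrite Es ltxx in s1.
Qed.

(** The first half of the half arc is left through one point only because [p] is
    an end; in the interior of a curve a small piece would have two fronts. *)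
Lemma front_init gam : C p -> half_arc_at p gam -> exists P z, front P z.
Proof.
move=> Cp [g0 cg ig og].
have h0 : 0 < (2^-1 : R) by rewrite invr_gt0.
have h1 : (2^-1 : R) < 1 by rewrite invf_lt1 // ltr1n.
have hb : 0 <= (2^-1 : R) < 1 by rewrite h1 ltW.
have cgw (b : R) : b < 1 -> {within `[0, b], continuous gam}.
  move=> b1; apply: continuous_subspaceW cg => t /=; rewrite !in_itv /=.
  by move=> /andP[-> tb]; exact: le_lt_trans tb b1.
have cg' (t : R) : 0 < t < 1 -> {for t, continuous gam}.
  move=> t1; have t01 : t \in `]0, 1[ by rewrite in_itv.
  have t01' : `[0, 1[%classic t.
    by rewrite /= in_itv /=; case/andP: t1 => /ltW -> ->.
  have /subspace_continuousP/(_ t t01') := cg.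
  rewrite within_interior //.
  apply: filterS (near_in_itvoo t01) => s.
  by rewrite /= !in_itv /= => /andP[/ltW -> ->].
pose B := gam @` [set t | 0 <= t < 2^-1].
have Bb (t : R) : 0 <= t < 2^-1 -> 0 <= t < 1.
  by move=> /andP[a b]; rewrite a (lt_trans b h1).
have clB : closure B `<=` gam @` `[0, 2^-1]%classic.
  rewrite [X in _ `<=` X]((closure_id _).1 _); last first.
    apply: compact_closed => //.
    by apply: continuous_compact; [exact: cgw|exact: segment_compact].
  apply: closure_subset => x [t /= /andP[a b] <-]; exists t => //=.
  by rewrite in_itv /= a ltW.
have clB' : closure B `<=` B `|` [set gam 2^-1].
  move=> x /clB[t /= tb <-]; move: tb; rewrite in_itv /= => /andP[t0].
  rewrite le_eqVlt => /orP[/eqP ->|tr]; first by right.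
  by left; exists t => //=; rewrite t0.
have nB (s : R) : 2^-1 <= s < 1 -> ~ B (gam s).
  move=> /andP[s1 s2] [t /= tb] /ig E; move: (tb); rewrite E.
  - by rewrite [X in _ && X]ltNge s1 andbF.
  - exact: Bb.
  - by rewrite s2 andbT (le_trans _ s1) // ltW.
have hb' : 0 < (2^-1 : R) < 1 by rewrite h0.
exists B, (gam 2^-1); split=> //.
- split; first by apply: og; exact: ltW.
  by exists 0; rewrite //= lexx h0.
- move=> x [t /= tb <-]; have /andP[t0 t1] := Bb _ tb.
  by apply/(C_arc t0 (cgw _ t1)); rewrite g0.
- split=> [|W /(cg' _ hb') /nbhs_ballP[e /= e0 He]].
    by apply: nB; rewrite lexx h1.
  pose s := Num.max 0 (2^-1 - e / 2).
  have s1 : s < 2^-1 by rewrite gt_max h0 /= ltrBlDr ltrDl divr_gt0.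
  exists (gam s); split.
    by exists s => //=; rewrite s1 le_max lexx.
  apply: He; rewrite /ball /= gtr0_norm ?subr_gt0 // ltrBlDr -ltrBlDl.
  rewrite lt_max; apply/orP; right.
  by rewrite ltrD2l ltrN2 ltr_pdivrMr // ltr_pMr // ltr1n.
- move=> /(cg' _ hb') /nbhs_ballP[e /= e0 He].
  pose d := Num.min e (1 - 2^-1) / 2.
  have m0 : 0 < Num.min e (1 - 2^-1) by rewrite lt_min e0 subr_gt0.
  have dm : d < Num.min e (1 - 2^-1) by rewrite /d ltr_pdivrMr // ltr_pMr // ltr1n.
  have d0 : 0 < d by rewrite divr_gt0.
  move: dm; rewrite lt_min => /andP[de db].
  have s1 : 2^-1 < 2^-1 + d by rewrite ltrDl.
  have s2 : 2^-1 + d < 1 by rewrite -ltrBrDl.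
  have : (gam @^-1` closure B) (2^-1 + d).
    by apply: He; rewrite /ball /= opprD addrA subrr add0r normrN gtr0_norm.
  move=> /clB'[|/= /ig E]; first by apply: nB; rewrite s2 ltW.
  have Es : 2^-1 + d = 2^-1.
    by apply: E => //; rewrite s2 andbT ltW // (lt_trans h0).
  by rewrite Es ltxx in s1.
Qed.

Section Chain.
Variable F : set (set T).
Hypothesis F_total : total_on F subset.
Hypothesis F_front : forall P, F P -> exists z, front P z.
Hypothesis F_ex : F !=set0.

Let V := \bigcup_(P in F) P.

(** If [V] were closed, then by compactness it would be a member of the chain,
    but members are not closed. *)
Lemma chain_not_closed : ~ closed V.
Proof.
move=> clV; have cV : compact V by apply: subclosed_compact clV T_compact _.
pose G := filter_from F (fun P => V `\` P).
have GF : ProperFilter G.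
  apply: filter_from_proper; first apply: filter_from_filter.
  - exact: F_ex.
  - move=> P Q FP FQ; have [PQ|QP] := F_total FP FQ.
      by exists Q => // x [Vx nQ]; split; split=> // /PQ.
    by exists P => // x [Vx nP]; split; split=> // /QP.
  - move=> P FP; apply: contrapT => H.
    have VP : V = P.
      apply/seteqP; split=> x Vx; last by exists P.
      by apply: contrapT => nP; apply: H; exists x.
    have [z [_ _ _ [nPz cPz] _]] := F_front FP.
    by apply: nPz; rewrite -VP; apply: clV; rewrite VP.
have GV : G V by have [P FP] := F_ex; exists P => // x [].
have [y [[P FP Py] Gy]] := cV G GF GV.
have [z [[oP _] _ _ _ _]] := F_front FP.
have GP : G (V `\` P) by exists P.
by have [x [[_ nPx] Px]] := Gy _ _ GP (near_open oP Py).
Qed.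

(** Read on an arc at [y], the fronts of the large members of the chain converge
    to [y] from one side, and [V] fills exactly that side. *)
Lemma chain_front_near y gam : closure V y -> ~ V y -> arc_at y gam ->
  exists gam', [/\ arc_at y gam',
    forall t, -1 < t < 1 -> V (gam' t) <-> t < 0 &
    forall W, nbhs y W -> exists2 P, F P &
      forall Q z, F Q -> P `<=` Q -> front Q z -> W z].
Proof.
move=> cVy nVy.
wlog [t0 /andP[t0l t0r] Vt0] : gam / exists2 t0 : R, -1 < t0 < 0 & V (gam t0).
  move=> H ag; have [g0 cg ig og] := ag.
  have Jy : nbhs y (gam @` [set t | -1 < t < 1]).
    apply: near_open; first exact: og.
    by exists 0 => //=; rewrite ltrN10 ltr01.
  have [x [Vx [t /= /andP[tl tr] tx]]] := cVy _ Jy.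
  have [t0|t0|t0] := ltgtP t 0.
  - by apply: (H gam _ ag); exists t; rewrite ?tl // tx.
  - apply: (H _ _ (arc_flip ag)); exists (- t); last by rewrite /= opprK tx.
    by rewrite ltrNl opprK tr ltrNl oppr0.
  - by exfalso; apply: nVy; rewrite -g0 -t0 tx.
move=> ag; have [g0 cg ig og] := ag.
have [P0 FP0 Pt0] := Vt0.
have zb : -1 < (0 : R) < 1 by rewrite ltrN10 ltr01.
have cut Q z : F Q -> P0 `<=` Q -> front Q z -> exists tau,
    [/\ t0 < tau <= 0, gam tau = z,
    forall t, -1 < t < tau -> Q (gam t) & forall t, tau <= t < 1 -> ~ Q (gam t)].
  move=> FQ P0Q fQ; apply: (front_cut fQ ag t0l t0r ltr01 (P0Q _ Pt0)).
  by rewrite g0 => Qy; apply: nVy; exists Q.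
have above Q : F Q -> exists2 Q', F Q' & Q `<=` Q' /\ P0 `<=` Q'.
  move=> FQ; have [QP|PQ] := F_total FQ FP0; last by exists Q => //; split.
  by exists P0 => //; split.
have Vneg t : -1 < t < 1 -> V (gam t) -> t < 0.
  move=> /andP[tl tr] [Q FQ Qt]; have [Q' FQ' [QQ' P0Q']] := above Q FQ.
  have [z fQ'] := F_front FQ'.
  have [tau [/andP[_ tau0] _ _ nQ]] := cut _ _ FQ' P0Q' fQ'.
  rewrite ltNge; apply/negP => t_ge0; apply: (nQ t); last exact: QQ'.
  by rewrite tr (le_trans tau0 t_ge0).
have negV t : -1 < t -> t < 0 -> exists2 Q, F Q & P0 `<=` Q /\ Q (gam t).
  move=> tl tr.
  have Jy : nbhs y (gam @` [set s | t < s < 1]).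
    apply: near_open; first by apply: og => //; exact: ltW.
    by exists 0; rewrite //= tr ltr01.
  have [x [[Q FQ Qx] [s /= /andP[sl sr] sx]]] := cVy _ Jy.
  have [Q' FQ' [QQ' P0Q']] := above Q FQ; have [z fQ'] := F_front FQ'.
  have [tau [_ _ lt_tau ge_tau]] := cut _ _ FQ' P0Q' fQ'.
  exists Q' => //; split=> //; apply: lt_tau; rewrite tl /=.
  apply: lt_trans sl _; rewrite ltNge; apply/negP => tau_s.
  by apply: (ge_tau s); [rewrite tau_s sr|apply: QQ'; rewrite sx].
exists gam; split=> //.
  move=> t tb; split; first exact: Vneg.
  by move=> t_lt0; case/andP: tb => tl _; have [Q FQ [_ Qt]] := negV t tl t_lt0; exists Q.
move=> W; rewrite -g0 => Wy.
have [s0 s0b Ws0] : exists2 s0 : R, -1 < s0 < 0 & forall s, s0 < s <= 0 -> W (gam s).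
  have /nbhs_ballP[e /= e0 He] := cg 0 zb W Wy.
  pose m := Num.min e 1 / 2.
  have mm : 0 < Num.min e 1 by rewrite lt_min e0 ltr01.
  have m0 : 0 < m by rewrite divr_gt0.
  have : m < Num.min e 1 by rewrite /m ltr_pdivrMr // ltr_pMr // ltr1n.
  rewrite lt_min => /andP[me m1].
  exists (- m); first by rewrite ltrN2 m1 oppr_lt0.
  move=> s /andP[s1 s2]; apply: He; rewrite /ball /= sub0r normrN ler0_norm //.
  by apply: lt_trans me; rewrite ltrNl.
have /andP[s0l s0r] := s0b.
have [P1 FP1 [P01 P1s0]] := negV s0 s0l s0r.
exists P1 => // Q z FQ P1Q fQ.
have [tau [/andP[_ tau0] <- _ ge_tau]] := cut Q z FQ (subset_trans P01 P1Q) fQ.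
apply: Ws0; rewrite tau0 andbT ltNge; apply/negP => tau_s0.
by apply: (ge_tau s0); [rewrite tau_s0 (lt_trans s0r ltr01)|exact: P1Q].
Qed.

(** The fronts of the members of the chain converge to every point of the
    frontier of [V]. As limits are unique, the frontier is a single point. *)
Lemma chain_front : (forall y, C y -> y <> p -> exists gam, arc_at y gam) ->
  exists z, front V z.
Proof.
move=> arcs.
have [P0 FP0] := F_ex; have [z0 [[_ P0p] _ _ _ _]] := F_front FP0.
have Vp : V p by exists P0.
have VC : V `<=` C.
  by move=> x [P FP Px]; have [z [_ PC _ _ _]] := F_front FP; exact: PC.
have arcs' y : closure V y -> ~ V y -> exists gam, arc_at y gam.
  move=> cVy nVy; apply: arcs.
    apply: C_closed; exact: (closure_subset VC cVy).
  by move=> E; apply: nVy; rewrite E.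
have [y [cVy nVy]] : exists y, closure V y /\ ~ V y.
  apply: contrapT => H; apply: chain_not_closed => y cVy.
  by apply: contrapT => nVy; apply: H; exists y.
have clV : closure V `<=` V `|` [set y].
  move=> x cVx; have [Vx|nVx] := pselect (V x); [by left|right].
  apply: contrapT => xy.
  have [gam ag] := arcs' y cVy nVy; have [gam2 ag2] := arcs' x cVx nVx.
  have [g [_ _ near_y]] := chain_front_near cVy nVy ag.
  have [g2 [_ _ near_x]] := chain_front_near cVx nVx ag2.
  have : ~ cluster (nbhs x) y by move=> /T_hausdorff.
  move=> /existsNP [A /existsNP [B /not_implyP [xA /not_implyP [yB nAB]]]].
  have [P FP HP] := near_x A xA; have [P' FP' HP'] := near_y B yB.
  have [Q [FQ PQ P'Q]] : exists Q, [/\ F Q, P `<=` Q & P' `<=` Q].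
    by have [PP'|P'P] := F_total FP FP'; [exists P'; split|exists P; split].
  have [z fQ] := F_front FQ.
  by apply: nAB; exists z; split; [exact: HP fQ|exact: HP' fQ].
have [gam ag] := arcs' y cVy nVy.
have [g [ag' Vg _]] := chain_front_near cVy nVy ag.
exists y; split=> //.
  split=> //; apply: bigcup_open => P FP.
  by have [z [[oP _] _ _ _ _]] := F_front FP.
move=> nb; have [g0 _ ig _] := ag'.
have zb : -1 < (0 : R) < 1 by rewrite ltrN10 ltr01.
rewrite -g0 in nb; have [s /andP[s0 s1] /clV] := arc_right ag' zb ltr01 nb.
have sb : -1 < s < 1 by rewrite s1 (lt_trans _ s0) // ltrN10.
case=> [/(Vg s sb)|/=]; first by rewrite ltNge ltW.
by rewrite -g0 => /(ig _ _ sb zb) E; rewrite E ltxx in s0.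
Qed.

End Chain.

(** Otherwise every front could be pushed further by [front_extend], in
    contradiction with a maximal piece of curve, which exists by Zorn's lemma
    and [chain_front]. *)
Lemma half_arc_other_end gam : C p -> half_arc_at p gam ->
  exists y, [/\ C y, y <> p & forall g, ~ arc_at y g].
Proof.
move=> Cp hg; apply: contrapT => H.
have arcs y : C y -> y <> p -> exists g, arc_at y g.
  move=> Cy yp; apply: contrapT => ng; apply: H; exists y; split=> // g ag.
  by apply: ng; exists g.
(* The empty set is admitted for the sake of the empty chain. *)
pose Q (X : set T) := X = set0 \/ exists z, front X z.
have [|A [QA maxA]] := @Zorn_bigcup T Q.
  move=> F FQ Ftot; pose F' := [set X | F X /\ exists z, front X z].
  have FF' : \bigcup_(X in F) X = \bigcup_(X in F') X.
    apply/seteqP; split=> x [X]; last by move=> [FX _] Xx; exists X.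
    move=> FX Xx; exists X => //; split=> //.
    by case: (FQ X FX) => // X0; rewrite X0 in Xx.
  rewrite FF'; have [F'0|F'n] := pselect (F' !=set0); last first.
    by left; apply/seteqP; split=> x // [X F'X _]; apply: F'n; exists X.
  right; apply: chain_front => //.
  - by move=> X Y [FX _] [FY _]; exact: Ftot.
  - by move=> X [].
case: QA => [A0|[z fA]].
  have [P [z fP]] := front_init Cp hg.
  apply: (maxA P); last by right; exists z.
  rewrite A0; split=> // P0; have [[_ Pp] _ _ _ _] := fP.
  by have := P0 p Pp.
have [[oA Ap] AC cA [nAz cAz] nz] := fA.
have Cz : C z by apply: C_closed; exact: (closure_subset AC cAz).
have zp : z <> p by move=> E; apply: nAz; rewrite E.
have [g ag] := arcs z Cz zp.
have [P' [z' [fP' AP' P'z]]] := front_extend fA ag.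
apply: (maxA P'); last by right; exists z'.
by split=> // /(_ z P'z).
Qed.

End Arcs.

Section Boundary1.
Variables (R : realType) (S : manifold R 1).

Definition line_chart (c : chart R 1 S) (a r t : R) : S :=
  param c (const_mx a + t *: const_mx r).

Lemma rV1_const (y : 'rV[R]_1) : y = const_mx (y 0 0).
Proof. by apply/rowP => i; rewrite mxE ord1. Qed.

Lemma line_chart_open (c : chart R 1 S) (a r : R) (D B : set R) :
  @atlas R 1 S c -> 0 < r -> open B ->
  (forall t, D t -> img c (const_mx a + t *: const_mx r) /\ B (a + t * r)) ->
  (forall x, dom c x -> B (coord c x 0 0) -> D ((coord c x 0 0 - a) / r)) ->
  open (line_chart c a r @` D).
Proof.
move=> ac r0 oB DB BD; have [od _ _ cc _] := atlas_chart ac.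
have oB' : open [set y : 'rV[R]_1 | B (y 0 0)].
  by apply: (@open_comp _ _ (fun y : 'rV[R]_1 => y 0 0)) => // y _; exact: coord_continuous.
have -> : line_chart c a r @` D = dom c `&` coord c @^-1` [set y | B (y 0 0)].
  apply/seteqP; split=> x.
    move=> [t /= Dt <-]; have [It Bt] := DB t Dt; have [dx xK] := img_param ac It.
    by split=> //=; rewrite xK !mxE.
  move=> [dx /= Bx]; exists ((coord c x 0 0 - a) / r); first exact: BD.
  rewrite /line_chart -[RHS](atlas_param ac dx); congr param.
  by apply/rowP => i; rewrite !mxE !ord1 mulfVK ?gt_eqF // addrC subrK.
move: cc; rewrite continuous_open_subspace // => cc.
by apply: open_setI_preimage => // x dx; apply: cc; rewrite inE.
Qed.

Lemma line_chart_inj (c : chart R 1 S) (a r : R) (s t : R) : @atlas R 1 S c -> 0 < r ->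
  img c (const_mx a + s *: const_mx r) -> img c (const_mx a + t *: const_mx r) ->
  line_chart c a r s = line_chart c a r t -> s = t.
Proof.
move=> ac r0 Is It /(congr1 (coord c)).
have [_ ->] := img_param ac Is; have [_ ->] := img_param ac It.
move=> /matrixP/(_ 0 0); rewrite !mxE => /addrI /mulIf; apply.
by rewrite gt_eqF.
Qed.

Lemma img_ge0 (c : chart R 1 S) y : @atlas R 1 S c -> img c y -> 0 <= y 0 0.
Proof. by move=> ac Iy; have [hy _] := half_space_chart ac Iy; exact: hy. Qed.

Lemma interior_arc (y : S) : ~ boundary y -> exists gam, arc_at (R := R) y gam.
Proof.
move=> nby; have [c ac cy] := atlas_cover y.
have Iy : img c (coord c y) by exists y.
have [hy [e e0 He]] := half_space_chart ac Iy.
set a := coord c y 0 0.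
have a0 : 0 < a.
  rewrite lt_neqAle hy // andbT; apply/eqP => E; apply: nby.
  by exists c; split=> //; exists 0; split=> //; rewrite -/a -E.
pose r := Num.min e a; have r0 : 0 < r by rewrite lt_min e0.
have bnd (t : R) : -1 < t < 1 -> `|t * r| < r.
  by move=> t1; rewrite normrM (gtr0_norm r0) gtr_pMl // ltr_norml.
have Ic (t : R) : -1 < t < 1 -> img c (const_mx a + t *: const_mx r).
  move=> t1; have := bnd t t1; rewrite {2}/r lt_min => /andP[te ta].
  apply: He; first by move=> i _; rewrite !mxE; move: ta; rewrite ltr_norml => /andP[]; lra.
  rewrite (rV1_const (coord c y)) -/a addrAC subrr add0r.
  rewrite /Num.Def.normr /= mx_normrE; apply/bigmax_ltP; split=> // -[i j] _ /=.
  by rewrite !mxE.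
exists (line_chart c a r); split.
- by rewrite /line_chart scale0r addr0 /a -rV1_const atlas_param.
- move=> t t1; have t1' : t \in `]-1, 1[ by rewrite in_itv.
  have cl : {within `]-1, 1[%classic, continuous (line_chart c a r)}.
    by apply: img_line_continuous => // s /=; rewrite in_itv; exact: Ic.
  move: cl => /subspace_continuousP/(_ t t1').
  by rewrite within_interior //; exact: near_in_itvoo t1'.
- by move=> s t s1 t1; apply: line_chart_inj => //; exact: Ic.
- move=> u v u1 v1.
  apply: (@line_chart_open c a r _ `]a + u * r, a + v * r[%classic) => //.
  + move=> t /= /andP[tu tv]; split.
      by apply: Ic; rewrite (le_lt_trans u1 tu) (lt_le_trans tv v1).
    by rewrite in_itv /= !ltrD2l !ltr_pM2r // tu.
  + move=> x dx /=; rewrite in_itv /= => /andP[xu xv].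
    by rewrite ltr_pdivlMr // ltr_pdivrMr // ltrBrDl xu ltrBlDl.
Qed.

Lemma boundary_half_arc (p : S) : boundary p -> exists gam, half_arc_at (R := R) p gam.
Proof.
move=> [c [ac cp [i [_]]]]; rewrite (ord1 i) => pi.
have Ip : img c (coord c p) by exists p.
have [hp [r r0 He]] := half_space_chart ac Ip.
have Ic (t : R) : 0 <= t < 1 -> img c (const_mx 0 + t *: const_mx r).
  move=> /andP[t0 t1]; apply: He.
    by move=> j _; rewrite !mxE add0r mulr_ge0 // ltW.
  rewrite (rV1_const (coord c p)) pi addrAC subrr add0r.
  rewrite /Num.Def.normr /= mx_normrE; apply/bigmax_ltP; split=> // -[j k] _ /=.
  by rewrite !mxE normrM (gtr0_norm r0) ger0_norm // gtr_pMl.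
exists (line_chart c 0 r); split.
- by rewrite /line_chart scale0r addr0 -pi -rV1_const atlas_param.
- by apply: img_line_continuous => // s /=; rewrite in_itv /=; exact: Ic.
- by move=> s t s1 t1; apply: line_chart_inj => //; exact: Ic.
- move=> v v1; apply: (@line_chart_open c 0 r _ `]-oo, v * r[%classic) => //.
  + move=> t /= /andP[t0 tv]; split; first by apply: Ic; rewrite t0 (lt_le_trans tv v1).
    by rewrite in_itv /= add0r ltr_pM2r.
  + move=> x dx /=; rewrite in_itv /= subr0 => xv.
    have x0 : 0 <= coord c x 0 0 by apply: (img_ge0 ac); exists x.
    by rewrite ltr_pdivrMr // xv divr_ge0 // ltW.
Qed.

(** Points off the boundary are centres of arcs, so the point without arc given
    by [half_arc_other_end] is on the boundary. *)
Lemma linked_boundary_points_dim1 (p : S) : compact [set: S] -> boundary p ->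
  exists q, [/\ boundary q, p <> q & linked R p q].
Proof.
move=> cS bp; have [gam hg] := boundary_half_arc bp.
have C_closed : closed [set x | linked R p x].
  rewrite -openC openE => x /= /existsNP [g /not_implyP [lg pgx]].
  rewrite /interior; apply: filterS (lg x) => y gy /= lpy.
  by apply: pgx; rewrite (lpy g lg).
have C_arc (g : R -> S) (a b : R) : a <= b -> {within `[a, b], continuous g} ->
    [set x | linked R p x] (g a) <-> [set x | linked R p x] (g b).
  move=> ab cg; have L := linked_arc ab cg; split=> H; first exact: linked_trans H L.
  exact: linked_trans H (linked_sym L).
have [y [Cy yp ny]] := half_arc_other_end (@manifold_hausdorff _ _ S) cS C_closed C_arc
  (fun g _ => erefl) hg.
exists y; split=> //; last by move=> E; exact: yp.
by apply: contrapT => nby; have [g ag] := interior_arc nby; exact: (ny g ag).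
Qed.

End Boundary1.

Lemma linked_boundary_points (R : realType) n (S : manifold R n) :
  compact [set: S] -> @boundary R n S !=set0 ->
  exists p q : S, [/\ boundary p, boundary q, p <> q & linked R p q].
Proof.
move=> cS [p bp]; case: n S cS p bp => [|[|n]] S cS p bp.
- by have [c [_ _ [[]]]] := bp.
- by have [q [bq pq lpq]] := linked_boundary_points_dim1 cS bp; exists p, q.
- have [q [bq pq lpq]] := linked_boundary_points_dim_ge2 (n := n.+2) isT bp.
  by exists p, q.
Qed.

(** * Flows at an equilibrium *)

(** The function [e t * exp (- K t)] is nonincreasing, so [e] vanishes to the
    right of [t0]; to the left, [e t * exp (K t)] is nondecreasing. *)
Lemma gronwall_zero (R : realType) (e de : R -> R) (t0 d K : R) :
  (forall t, `|t - t0| < d -> [/\ is_derive (t : R^o) (1 : R^o) (e : R^o -> R^o) (de t),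
     `|de t| <= K * e t & 0 <= e t]) ->
  e t0 = 0 -> forall t, `|t - t0| < d -> e t = 0.
Proof.
move=> H e0.
have dF (k t : R) : `|t - t0| < d ->
    is_derive (t : R^o) (1 : R^o) (fun s => e s * expR (k * s) : R^o)
      ((de t + k * e t) * expR (k * t)).
  move=> td; have [de_t _ _] := H t td.
  have dk : is_derive (t : R^o) (1 : R^o) (fun s : R => k * s : R^o) k.
    have := @is_deriveZ R R^o R^o id k t 1 1 (is_derive_id _ _).
    by rewrite [k *: 1]mulr1.
  have dx : is_derive (t : R^o) (1 : R^o) (fun s : R => expR (k * s) : R^o)
      (expR (k * t) * k) by exact: (@is_derive1_comp R expR (fun s => k * s)).
  have dM : is_derive (t : R^o) (1 : R^o) (fun s => e s * expR (k * s) : R^o) _ :=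
    is_deriveM de_t dx.
  apply: (is_derive_eq dM).
  by rewrite -![_ *: _]/(_ * _); ring.
have mono (k a b : R) : a <= b -> (forall s, a <= s <= b -> `|s - t0| < d) ->
    exists2 c, a <= c <= b & e b * expR (k * b) - e a * expR (k * a) =
      (de c + k * e c) * expR (k * c) * (b - a).
  move=> ab sd.
  have [||c] := @MVT_segment R (fun s => e s * expR (k * s))
     (fun t => (de t + k * e t) * expR (k * t)) a b ab.
  - by move=> s; rewrite in_itv /= => /andP[sa sb]; apply: dF; apply: sd; rewrite !ltW.
  - apply: derivable_within_continuous => s; rewrite in_itv /= => sab.
    by have [] := dF k s (sd s sab).
  by rewrite in_itv /= => cab E; exists c.
move=> t td; have [_ _ et_ge0] := H t td.
apply/eqP; rewrite eq_le et_ge0 andbT.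
have [t0t|tt0] := leP t0 t.
- have [s /andP[s1 s2]|c /andP[c1 c2]] := mono (- K) t0 t t0t.
    apply: le_lt_trans td; rewrite !ger0_norm ?subr_ge0 // lerD2r //.
  rewrite e0 mul0r subr0 => E.
  have cd : `|c - t0| < d.
    by apply: le_lt_trans td; rewrite !ger0_norm ?subr_ge0 // lerD2r.
  have [_ dc _] := H c cd.
  rewrite -(pmulr_lle0 _ (expR_gt0 (- K * t))) E -mulrA.
  apply: mulr_le0_ge0; last by rewrite mulr_ge0 ?expR_ge0 // subr_ge0.
  by rewrite mulNr subr_le0; apply: le_trans dc; exact: ler_norm.
- have tt0' := ltW tt0.
  have [s /andP[s1 s2]|c /andP[c1 c2]] := mono K t t0 tt0'.
    by apply: le_lt_trans td; rewrite !ler0_norm ?subr_le0 // lerN2 lerD2r.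
  rewrite e0 mul0r sub0r => E.
  have cd : `|c - t0| < d.
    by apply: le_lt_trans td; rewrite !ler0_norm ?subr_le0 // lerN2 lerD2r.
  have [_ dc _] := H c cd.
  rewrite -(pmulr_lle0 _ (expR_gt0 (K * t))) -oppr_ge0 E -mulrA.
  apply: mulr_ge0; last by rewrite mulr_ge0 ?expR_ge0 // subr_ge0.
  by move: dc; rewrite ler_norml => /andP[+ _]; rewrite -subr_ge0 opprK.
Qed.

Lemma C1_lipschitz (R : realType) m (U : set 'rV[R]_m) (f : 'rV[R]_m -> R^o) x :
  open U -> Ck 1 U f -> U x ->
  exists L d : R, [/\ 0 <= L, 0 < d &
    forall y, `|y - x| < d -> `|f y - f x| <= L * `|y - x|].
Proof.
move=> oU Cf Ux.
have df : differentiable f x.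
  apply: (@C1_differentiable _ _ U) => //; first by move=> y w; exact: (Cf.2 w).1.
  by move=> y w; exact: (Cf.2 w).2.1.
have [k k0 kf] := linear_lipschitz (diff_continuous df).
have /eqaddoP /(_ 1 ltr01) /nbhs_ballP[d /= d0 Hd] := diff_locally df.
exists (k + 1), d; split=> //; first by rewrite addr_ge0 // ltW.
move=> y yd; have /Hd : ball 0 d (y - x) by rewrite -ball_normE /= sub0r normrN.
rewrite /= !fctE /= subrK mul1r opprD addrA => H.
rewrite mulrDl mul1r -[X in `|X|](subrK ('d f x (y - x))) addrC.
apply: le_trans (ler_normD _ _) _; rewrite lerD //; exact: kf.
Qed.

Section TangentSum.
Variables (R : realType) (n : nat) (N : manifold R n) (p : N) (D : tvec N).
Hypothesis tD : tangent p D.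

Lemma tangent0 : D (fun=> 0) = 0.
Proof.
have [_ /(_ 1 _ _ (@smooth_fun_cst _ _ N 0) (@smooth_fun_cst _ _ N 0)) + _] := tD.
have -> : (fun=> 1 * 0 + 0 : R) = (fun _ : N => 0).
  by apply/funext => x; rewrite mulr0 addr0.
by rewrite mul1r => /eqP; rewrite -subr_eq subrr eq_sym => /eqP.
Qed.

Lemma tangentD f g : smooth_fun f -> smooth_fun g ->
  D (fun x => f x + g x) = D f + D g.
Proof.
move=> sf sg; have [_ /(_ 1 _ _ sf sg) + _] := tD; rewrite mul1r => <-.
by congr D; apply/funext => x; rewrite mul1r.
Qed.

Lemma tangentZ a f : smooth_fun f -> D (fun x => a * f x) = a * D f.
Proof.
move=> sf; have [_ /(_ a _ _ sf (@smooth_fun_cst _ _ N 0)) + _] := tD.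
rewrite tangent0 addr0 => <-.
by congr D; apply/funext => x; rewrite addr0.
Qed.

Lemma tangent_sum k (f : 'I_k -> N -> R) : (forall i, smooth_fun (f i)) ->
  D (fun x => \sum_(i < k) f i x) = \sum_(i < k) D (f i).
Proof.
elim: k f => [|k IH] f sf.
  by rewrite big_ord0; under eq_fun do rewrite big_ord0; exact: tangent0.
under eq_fun do rewrite big_ord_recl; rewrite big_ord_recl tangentD //.
  by rewrite IH.
exact: smooth_fun_sum.
Qed.

End TangentSum.

Section Stationary.
Variables (R : realType) (n : nat) (M : manifold R n) (xi : M -> tvec M) (x : M).
Hypotheses (M_boundaryless : @boundary R n M = set0) (Vxi : vector_field xi).
Hypothesis xi_x : forall f, smooth_fun f -> xi x f = 0.

(** [E] is the sum of the squares of the coordinates centred at [x], cut off by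
    a bump function. Since [xi] is a derivation, [xi E] is a sum of products of
    a coordinate with its derivative along [xi]. The derivative is smooth and
    vanishes at [x], so both factors are bounded by a multiple of the distance
    to [x], whose square is at most a multiple of [E]. *)
Lemma energy_at_zero : exists (E : M -> R) (W : set M) (K : R),
  [/\ smooth_fun E, (forall y, 0 <= E y) /\ E x = 0, open W /\ W x,
      forall y, W y -> E y = 0 -> y = x &
      forall y, W y -> `|xi y E| <= K * E y].
Proof.
have [c ac cx] := atlas_cover x; have oc := open_img M_boundaryless ac.
have [r [r0 _ Hr]] := chart_ball M_boundaryless ac cx ltr01.
set y0 := coord c x; pose b := bump y0 r.
have Iy0 : img c y0 by exists x.
have b0 : 0 < b y0 by exact: bump_gt0.
pose Y i := extend0 c (fun y => b y * (y 0 i - y0 0 i)).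
have sY i : smooth_fun (Y i).
  apply: (smooth_extend0 M_boundaryless ac r0 Hr).
    move=> k; apply: Ck_mul => //; first exact: Ck_bump.
    apply: (@Ck_add _ _ R^o) => //; last exact: Ck_cst.
    exact: (Ck_coord i oc (@Ck_id _ _ _ _)).
  move=> y; rewrite mulf_eq0 negb_or => /andP[by0 _].
  exact/ltW/(bump_supp r0).
have [_ sxi] := Vxi.
pose g i y := xi y (Y i).
have sg i : smooth_fun (g i) by exact: sxi.
have gx i : g i x = 0 by exact: xi_x.
have /choice[Ld HLd] (i : 'I_n) : exists Ld : R * R,
    [/\ 0 <= Ld.1, 0 < Ld.2 & forall y : 'rV[R]_n, `|y - y0| < Ld.2 ->
      `|g i (param c y)| <= Ld.1 * `|y - y0| ].
  have [L [d [L0 d0 H]]] := C1_lipschitz oc (smooth_fun_Ck M_boundaryless 1 ac (sg i)) Iy0.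
  exists (L, d); split=> // y yd.
  by have := H y yd; rewrite /= (atlas_param ac cx) gx subr0.
pose L := \sum_i (Ld i).1.
have L0 : 0 <= L by apply: sumr_ge0 => i _; have [] := HLd i.
have lipL : \forall d \near (0 : R)^'+,
    forall i (y : 'rV[R]_n), `|y - y0| < d -> `|g i (param c y)| <= L * `|y - y0|.
  apply: filter_forall => i; have [_ d0 H] := HLd i.
  near=> d => y yd; apply: le_trans (H y _) _.
    by apply: lt_le_trans yd _; near: d; exact: nbhs_right_le.
  apply: ler_wpM2r => //; rewrite /L (bigD1 i) //= lerDl.
  by apply: sumr_ge0 => j _; have [] := HLd j.
have bcont : {for y0, continuous (b : 'rV[R]_n -> R^o)}.
  by apply: (@Ck_continuous _ _ R^o 0%N (img c)) => //; exact: Ck_bump.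
have b20 : 0 < b y0 / 2 by rewrite divr_gt0.
have [d1 d10 Hd1] := (continuous_epsP _ _).1 bcont _ b20.
have [d [d0 dd1 Hd]] : exists d : R, [/\ 0 < d, d <= d1 &
    forall i (y : 'rV[R]_n), `|y - y0| < d -> `|g i (param c y)| <= L * `|y - y0|].
  near (0 : R)^'+ => d; exists d; split; near: d.
  - exact: nbhs_right_gt.
  - exact: nbhs_right_le.
  - exact: lipL.
pose beta := b y0 / 2.
have bbeta y : `|y - y0| < d -> beta < b y.
  move=> yd; have := Hd1 y (lt_le_trans yd dd1); rewrite ltr_norml => /andP[+ _].
  by rewrite /beta; set u := b y; set v := b y0; lra.
have [od _ _ cc _] := atlas_chart ac.
pose B := [set y : 'rV[R]_n | `|y - y0| < d].
have oB : open B.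
  have -> : B = ball y0 d; last exact: ball_open.
  by apply/seteqP; split=> y; rewrite /B -ball_normE /= distrC.
pose W := dom c `&` coord c @^-1` B.
have oW : open W.
  move: cc; rewrite continuous_open_subspace // => cc.
  by apply: open_setI_preimage => // y dy; apply: cc; rewrite inE.
pose E y := \sum_(i < n) Y i y * Y i y.
have YE i y : W y -> Y i y = b (coord c y) * (coord c y 0 i - y0 0 i).
  by move=> [dy _]; rewrite /Y /extend0 asboolT.
have E_ge0 y : 0 <= E y by apply: sumr_ge0 => i _; rewrite -expr2 sqr_ge0.
have YE_le i y : Y i y * Y i y <= E y.
  rewrite /E (bigD1 i) //= lerDl; apply: sumr_ge0 => j _.
  by rewrite -expr2 sqr_ge0.
exists E, W, (n%:R * (L * (1 + beta ^- 2))); split.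
- by apply: smooth_fun_sum => i; exact: smooth_funM.
- split=> //; rewrite /E big1 // => i _.
  by rewrite /Y /extend0 asboolT // subrr mulr0 mul0r.
- by split=> //; split=> //; rewrite /= /B /= subrr normr0.
- move=> y Wy Ey0; have [dy By] := Wy.
  suff yE : coord c y = y0 by rewrite -(atlas_param ac dy) yE /y0 atlas_param.
  apply/rowP => i; apply/eqP; rewrite -subr_eq0.
  have : Y i y * Y i y == 0.
    by rewrite eq_le -{1}Ey0 YE_le -expr2 sqr_ge0.
  rewrite mulf_eq0 orbb YE // mulf_eq0 => /orP[/eqP bz|//].
  by have := bbeta _ By; rewrite bz ltNge ltW.
move=> y Wy; have [dy By] := Wy.
have ty : tangent y (xi y) by exact: Vxi.1.
have -> : xi y E = \sum_(i < n) 2 * (Y i y * g i y).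
  rewrite /E (tangent_sum ty (f := fun i z => Y i z * Y i z)); last first.
    by move=> i; exact: smooth_funM.
  apply: eq_bigr => i _; have [_ _ ->] := ty; [|exact: sY|exact: sY].
  by rewrite /g [X in _ + X]mulrC mulr2n mulrDl mul1r.
have yn : `|coord c y - y0| ^+ 2 <= beta ^- 2 * E y.
  have [->|] := eqVneq (coord c y - y0) 0.
    by rewrite normr0 expr0n mulr_ge0 // invr_ge0 sqr_ge0.
  move/eqP => yn0.
  have [[i0 i] /= ->] : exists ij : 'I_1 * 'I_n,
      `|coord c y - y0| = `|(coord c y - y0) ij.1 ij.2|.
    apply: mx_norm_neq0; apply/eqP => /mx_norm_eq0; exact: yn0.
  rewrite (ord1 i0) !mxE real_normK ?num_real //.
  rewrite mulrC ler_pdivlMr ?exprn_gt0 //.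
  apply: le_trans (YE_le i y); rewrite YE // -expr2 !exprMn [leLHS]mulrC.
  apply: ler_wpM2r; first exact: sqr_ge0.
  rewrite -exprMn -/beta.
  rewrite ler_pXn2r ?nnegrE ?(ltW b20) //.
    by exact/ltW/bbeta.
  by apply: ltW; apply: lt_trans b20 _; exact: bbeta.
apply: le_trans (ler_norm_sum _ _ _) _.
apply: (@le_trans _ _ (\sum_(i < n) L * (1 + beta ^- 2) * E y)); last first.
  by rewrite sumr_const card_ord -[leLHS]mulr_natl !mulrA.
apply: ler_sum => i _.
have gi : `|g i y| <= L * `|coord c y - y0|.
  by have := Hd i (coord c y) By; rewrite atlas_param.
rewrite !normrM ger0_norm //.
set u := `|Y i y|; set v := `|coord c y - y0| in gi yn *.
have u0 : 0 <= u by exact: normr_ge0.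
have v0 : 0 <= v by exact: normr_ge0.
have uE : u ^+ 2 <= E y by rewrite /u real_normK ?num_real // expr2.
(* [2 u v <= u^2 + v^2] avoids square roots of [E]. *)
apply: (@le_trans _ _ (L * (u ^+ 2 + v ^+ 2))).
  apply: (@le_trans _ _ (2 * (u * (L * v)))).
    by rewrite ler_wpM2l // ler_wpM2l.
  have -> : 2 * (u * (L * v)) = L * (2 * u * v) by ring.
  apply: ler_wpM2l => //; rewrite -subr_ge0.
  have -> : u ^+ 2 + v ^+ 2 - 2 * u * v = (u - v) ^+ 2 by ring.
  exact: sqr_ge0.
by rewrite -mulrA ler_wpM2l // mulrDl mul1r lerD.
Unshelve. all: by end_near. Qed.

(** Uniqueness of solutions at an equilibrium. By [gronwall_zero], applied to
    the energy, to be at [x] is an open condition on [t]; it is also a closed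
    one, and the interval is connected. *)
Lemma stationary_flow (gam : R -> M) (eps : R) : continuous gam -> 0 < eps ->
  gam 0 = x ->
  (forall t, `|t| < eps -> forall f, smooth_fun f ->
     is_derive (t : R^o) (1 : R^o) (fun r => f (gam r) : R^o) (xi (gam t) f)) ->
  forall t, `|t| < eps -> gam t = x.
Proof.
move=> cg eps0 g0 dg.
have [E [W [K [sE [E0 Ex] [oW Wx] WE xiE]]]] := energy_at_zero.
pose k (t : R) : R := (`[< gam t = x >] : bool)%:R.
have loc t : `|t| < eps -> \forall s \near t, k s = k t.
  move=> te; have [gt|gt] := pselect (gam t = x); last first.
    have oV : open (~` [set x]).
      apply/closed_openC/accessible_closed_set1/hausdorff_accessible.
      exact: manifold_hausdorff.
    have nt : nbhs t (gam @^-1` (~` [set x])).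
      by apply: cg; exact: (near_open oV gt).
    by apply: filterS nt => s ns; rewrite /k !asboolF.
  have : nbhs t (gam @^-1` W) by apply: cg; rewrite gt; exact: near_open.
  move=> /nbhs_ballP[d /= d0 Hd].
  have m0 : 0 < Num.min d (eps - `|t|) by rewrite lt_min d0 subr_gt0.
  apply/nbhs_ballP; exists (Num.min d (eps - `|t|)) => //= s.
  rewrite -ball_normE /= distrC => sd.
  suff gs : gam s = x by rewrite /k gs gt.
  have near_t r : `|r - t| < Num.min d (eps - `|t|) -> W (gam r) /\ `|r| < eps.
    rewrite lt_min => /andP[rd re]; split; first by apply: Hd; rewrite -ball_normE /= distrC.
    rewrite -[r](subrK t); apply: le_lt_trans (ler_normD _ _) _.
    by rewrite -ltrBrDr.
  apply: WE; first by have [] := near_t s sd.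
  apply: (@gronwall_zero R (E \o gam) (fun r => xi (gam r) E) t
    (Num.min d (eps - `|t|)) K) => //; last by rewrite /= gt.
  move=> r rd; have [Wr re] := near_t r rd.
  by split; [exact: dg|exact: xiE|exact: E0].
move=> t te.
suff : k t = k 0.
  rewrite /k g0 (asboolT (erefl x)); case: asboolP => // _ /= /eqP.
  by rewrite eq_sym oner_eq0.
have id_within (a b : R) : {within `[a, b], continuous (id : R -> R)}.
  by apply: continuous_subspaceT => s; exact: cvg_id.
have [t0|t0] := leP 0 t.
- apply/esym; apply: (@constant_along_arc R R k id 0 t t0 (id_within _ _)) => s /andP[s0 st].
  by apply: loc; rewrite ger0_norm //; apply: le_lt_trans te; rewrite ger0_norm.
- apply: (@constant_along_arc R R k id t 0 (ltW t0) (id_within _ _)) => s /andP[st s0].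
  by apply: loc; rewrite ler0_norm //; apply: le_lt_trans te; rewrite ltr0_norm // lerN2.
Qed.

End Stationary.

(** * Smooth families and their time derivatives *)

Lemma derive1_near_cst (R : realType) (g : R -> R) (a : R) :
  (\forall t \near (0 : R), g t = a) -> derive1 (fun t : R => g t : R^o) 0 = 0.
Proof.
move=> ga; rewrite derive1E (@near_eq_derive R R^o R^o _ (cst a)) //.
exact: derive_cst.
Qed.

Lemma near_ball0 (R : realType) (eps : R) : 0 < eps -> \forall t \near (0 : R), `|t| < eps.
Proof. by move=> e0; exact: (@nbhs0_lt R R^o). Qed.

Section Families.
Variables (R : realType) (n : nat) (S : manifold R n).

Lemma rsubmx_continuous : continuous (rsubmx : 'rV[R]_(1 + n) -> 'rV[R]_n).
Proof. by move=> u; apply: differentiable_continuous; exact: differentiable_rsubmx. Qed.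

Lemma rsubmx_affine : exists L : {linear 'rV[R]_(1 + n) -> 'rV[R]_n},
  forall u, rsubmx u = 0 + L u.
Proof.
have lin : linear (rsubmx : 'rV[R]_(1 + n) -> 'rV[R]_n).
  by move=> a u v; apply/rowP => i; rewrite !mxE.
pose LM := GRing.isLinear.Build _ _ _ _ _ lin.
pose L : {linear 'rV[R]_(1 + n) -> 'rV[R]_n} :=
  HB.pack (rsubmx : 'rV[R]_(1 + n) -> 'rV[R]_n) LM.
by exists L => u; rewrite add0r.
Qed.

Lemma smooth_on_rsubmx (W : normedModType R) (B : set 'rV[R]_n) (f : 'rV[R]_n -> W) :
  smooth_on B f ->
  smooth_on [set u : 'rV[R]_(1 + n) | B (rsubmx u)] (fun u => f (rsubmx u)).
Proof.
have [L LE] := rsubmx_affine => sf.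
exact: (smooth_on_affine rsubmx_continuous LE sf).
Qed.

Lemma smooth_on_time (A : set 'rV[R]_(1 + n)) :
  smooth_on (W := R^o) A (fun u => lsubmx u 0 0).
Proof.
apply: (@Ck_smooth_on _ _ _ _ setT) => //; last exact: openT.
move=> k; have := @Ck_coord R (1 + n) k setT (1 + n) id (lshift n 0) openT (@Ck_id _ _ _ _).
by apply: Ck_eq; [exact: openT|move=> x _; rewrite mxE].
Qed.

Lemma smooth_fun_family_scale (g : S -> R) : smooth_fun g ->
  smooth_fun_family (fun t s => t * g s).
Proof.
move=> sg c ac; apply: smooth_on_mul; first exact: smooth_on_time.
exact: (smooth_on_rsubmx (sg c ac)).
Qed.

Lemma smooth_fun_slice (h : R -> S -> R) t : smooth_fun_family h -> smooth_fun (h t).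
Proof.
move=> sh c ac; have [L LE] := @slice_affine R t n.
have H := smooth_on_affine (@slice_continuous R t n) LE (sh c ac).
apply: (@smooth_on_eq _ _ _ _ _ _ _ (smooth_on_sub _ H)) => [u _|u Iu] /=.
  by rewrite slice_l slice_r.
by rewrite slice_r.
Qed.

Definition time_dir : 'rV[R]_(1 + n) := row_mx 1%:M 0.
Definition space_dir (v : 'rV[R]_n) : 'rV[R]_(1 + n) := row_mx 0 v.

Lemma slice_time (t : R) (y : 'rV[R]_n) : slice t y = slice 0 y + t *: time_dir.
Proof.
rewrite /slice /time_dir scale_row_mx add_row_mx scaler0 addr0.
by rewrite scale_scalar_mx mulr1 -raddfD add0r.
Qed.

Lemma slice_space (t h : R) (y v : 'rV[R]_n) :
  slice t (h *: v + y) = h *: space_dir v + slice t y.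
Proof. by rewrite /slice /space_dir scale_row_mx add_row_mx scaler0 add0r. Qed.

Definition time_derivative (h : R -> S -> R) (s : S) : R :=
  derive1 (fun t : R => h t s : R^o) 0.

Lemma derive_slice (H : 'rV[R]_(1 + n) -> R^o) t (y v : 'rV[R]_n) :
  'D_v (H \o @slice R t n) y = 'D_(space_dir v) H (slice t y).
Proof.
rewrite /derive; set F := (X in lim (X @ _)); set G := (X in _ = lim (X @ _)).
suff -> : F = G by [].
by apply/funext => h; rewrite /F /G /= slice_space.
Qed.

Lemma smooth_time_derivative (h : R -> S -> R) :
  smooth_fun_family h -> smooth_fun (time_derivative h).
Proof.
move=> sh c ac u Iu.
have I0 : [set u : 'rV[R]_(1 + n) | img c (rsubmx u)] (slice 0 u).
  by rewrite /= slice_r.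
have [U [H [oU Uu CH HE]]] := sh c ac _ I0.
have [L LE] := @slice_affine R 0 n.
have cs := @slice_continuous R 0 n.
exists (@slice R 0 n @^-1` U), ('D_time_dir H \o @slice R 0 n); split=> //.
- by apply: open_comp => // y _; exact: cs.
- by move=> k; apply: (Ck_affine cs LE oU); exact: ((CH k.+1).2 _).2.
move=> y Iy Uy /=; rewrite /time_derivative derive1E.
have dH : derivable H (slice 0 y + (0 : R) *: time_dir) time_dir.
  by rewrite scale0r addr0; exact: ((CH 1%N).2 _).1.
have [_] := is_derive_line dH; rewrite scale0r addr0 => <-.
apply: near_eq_derive.
have ct : {for (0 : R), continuous (fun t : R => slice t y)}.
  have -> : (fun t : R => slice t y) = (fun t => slice 0 y + t *: time_dir).
    by apply/funext => t; exact: slice_time.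
  apply: (@continuousD _ _ _ (fun=> slice 0 y) (fun t : R => t *: time_dir)).
    exact: cst_continuous.
  exact: scalel_continuous.
have nU : nbhs (0 : R) ((fun t : R => slice t y) @^-1` U).
  by apply: ct; exact: (near_open oU Uy).
apply: filterS nU => t Ut; rewrite -slice_time HE //.
  by rewrite slice_l slice_r.
by rewrite /= slice_r.
Qed.

(** Symmetry of second derivatives in the directions [time_dir] and [space_dir
    v]. *)
Lemma dirder_time_derivative (h : R -> S -> R) (c : chart R n S)
    (x v : 'rV[R]_n) (V : set 'rV[R]_n) :
  smooth_fun_family h -> @atlas R n S c -> open V -> V `<=` img c -> V x ->
  is_derive (0 : R^o) (1 : R^o) (fun t : R => dirder c x v (h t) : R^o)
    (dirder c x v (time_derivative h)).
Proof.
move=> sh ac oV Vc Vx.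
pose H : 'rV[R]_(1 + n) -> R^o := fun u => h (lsubmx u 0 0) (param c (rsubmx u)).
pose B := [set u : 'rV[R]_(1 + n) | V (rsubmx u)].
have oB : open B by apply: open_comp => // u _; exact: rsubmx_continuous.
have CH k : Ck k B H by apply: smooth_on_Ck (sh c ac) oB _ => u; exact: Vc.
have Bs t y : V y -> B (slice t y) by rewrite /B /= slice_r.
have hE t : (h t \o param c : _ -> R^o) = H \o @slice R t n.
  by apply/funext => y; rewrite /H /= slice_l slice_r.
have DE t : dirder c x v (h t) = 'D_(space_dir v) H (slice t x).
  by rewrite dirderE ?hE ?derive_slice //; exact: smooth_fun_slice.
have dtE y : V y -> (time_derivative h \o param c) y = 'D_time_dir H (slice 0 y).
  move=> Vy; rewrite /= /time_derivative derive1E.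
  have dH : derivable H (slice 0 y + (0 : R) *: time_dir) time_dir.
    by rewrite scale0r addr0; apply: ((CH 1%N).2 _).1; exact: Bs.
  have [_] := is_derive_line dH; rewrite scale0r addr0 => <-.
  have -> // : (fun t : R => h t (param c y) : R^o) =
      (fun r : R^o => H (slice 0 y + r *: time_dir)).
  by apply/funext => t; rewrite -slice_time /H slice_l slice_r.
have dD : derivable ('D_(space_dir v) H) (slice 0 x + (0 : R) *: time_dir) time_dir.
  rewrite scale0r addr0.
  exact: (((CH 2%N).2 _).2.2 _).1 (Bs 0 x Vx).
have := is_derive_line dD; rewrite scale0r addr0.
rewrite (schwarz _ _ oB (CH 2%N) (Bs 0 x Vx)) -derive_slice.
have -> : 'D_v ('D_time_dir H \o @slice R 0 n) x =
    dirder c x v (time_derivative h).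
  rewrite dirderE; last exact: smooth_time_derivative.
  apply: near_eq_derive; apply: filterS (near_open oV Vx) => y Vy.
  by rewrite dtE.
congr is_derive; apply/funext => t.
by rewrite DE -slice_time.
Qed.

End Families.

(** * Forms along an embedding, and the momentum map *)

Section ExteriorDerivative.
Variables (R : realType) (n : nat) (S : manifold R n).

Lemma ext_d_tangent (f : S -> R) s (u : tvec S) : tangent s u -> ext_d f s u = u f.
Proof. by move=> tu; rewrite /ext_d asboolT. Qed.

Lemma ext_d_notin (f : S -> R) s (u : tvec S) : ~ tangent s u -> ext_d f s u = 0.
Proof. by move=> tu; rewrite /ext_d asboolF. Qed.

Lemma ext_dD (f g : S -> R) s (u : tvec S) : smooth_fun f -> smooth_fun g ->
  ext_d (fun x => f x + g x) s u = ext_d f s u + ext_d g s u.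
Proof.
move=> sf sg; rewrite /ext_d; case: asboolP => [tu|_]; last by rewrite addr0.
exact: (tangentD tu sf sg).
Qed.

Lemma ext_dZ (a : R) (f : S -> R) s (u : tvec S) : smooth_fun f ->
  ext_d (fun x => a * f x) s u = a * ext_d f s u.
Proof.
move=> sf; rewrite /ext_d; case: asboolP => [tu|_]; last by rewrite mulr0.
exact: (tangentZ tu a sf).
Qed.

Lemma ext_d0 s (u : tvec S) : ext_d (fun _ : S => 0) s u = 0.
Proof. by rewrite /ext_d; case: asboolP => // tu; exact: (tangent0 tu). Qed.

Lemma mod_exact_ext_d (k : S -> R) : smooth_fun k ->
  mod_exact (ext_d k) = mod_exact (fun _ _ => 0).
Proof.
move=> sk; apply/seteqP; split=> beta [ob [h sh bE]]; split=> //.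
  exists (fun x => k x + h x); first exact: smooth_funD.
  by rewrite bE; apply/funext => s; apply/funext => u; rewrite ext_dD // add0r.
exists (fun x => h x - k x); first exact: smooth_funB.
rewrite bE; apply/funext => s; apply/funext => u; rewrite add0r.
rewrite -ext_dD //; last exact: smooth_funB.
by congr (ext_d _ s u); apply/funext => x; rewrite addrC subrK.
Qed.

End ExteriorDerivative.

Section Forms.
Variables (R : realType) (n : nat) (S M : manifold R n).
Variable phi : S -> M.
Hypothesis smphi : smooth_map phi.

(** The factor [a] is there because [t |-> d_along phi t f] is the curve of
    forms used against the Lie algebra. *)
Definition d_along (a : R) (f : M -> R) (s : S) (w : tvec M) : R :=
  a * ext_d f (phi s) w.

Lemma d_along_oneform a f : smooth_fun f -> oneform_along phi (d_along a f).
Proof.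
move=> sf; split=> [s|X [tX sX]].
  split=> [D nD|r D E tD tE]; rewrite /d_along; first by rewrite ext_d_notin ?mulr0.
  rewrite !ext_d_tangent //; first by rewrite mulrDr mulrCA.
  have [D0 Dl Dm] := tD; have [E0 El Em] := tE; split.
  - by move=> g ng; rewrite D0 // E0 // mulr0 addr0.
  - by move=> b g h sg sh; rewrite Dl // El //; ring.
  - by move=> g h sg sh; rewrite Dm // Em //; ring.
have -> : (fun s => d_along a f s (X (phi s))) =
    (fun s => a * ((fun p => X p f) \o phi) s).
  by apply/funext => s; rewrite /d_along ext_d_tangent.
by apply: smooth_funZ; apply: smooth_fun_comp => //; exact: sX.
Qed.

Lemma pull_d_along a f : smooth_fun f ->
  pull phi (d_along a f) = ext_d (fun s => a * f (phi s)).
Proof.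
move=> sf; apply/funext => s; apply/funext => u.
rewrite (ext_dZ _ _ _ (smooth_fun_comp smphi sf)) /pull; case: asboolP => tu.
  rewrite /d_along (ext_d_tangent _ (tangent_push smphi tu)) pushE //.
  by rewrite (ext_d_tangent _ tu).
by rewrite (ext_d_notin _ tu) mulr0.
Qed.

Lemma mem_class alpha : oneform_along phi alpha -> (class phi alpha).2 alpha.
Proof.
move=> oa; split=> //; exists (fun=> 0); split=> //; first exact: smooth_fun_cst.
by apply/funext => s; apply/funext => u; rewrite ext_d0 addr0.
Qed.

(** Exact forms vanish in the target of [J_R] whatever the boundary values of
    their primitives, whereas in the cotangent space those values matter. *)
Lemma J_R_exact alpha k : oneform_along phi alpha -> smooth_fun k ->
  pull phi alpha = ext_d k -> J_R (class phi alpha) = mod_exact (fun _ _ => 0).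
Proof.
move=> oa sk pE; apply/seteqP; split=> beta.
  move=> [alpha' [_ [h [sh _ ->]]]].
  have -> : (fun s u => pull phi alpha s u + ext_d h s u) =
      ext_d (fun x => k x + h x).
    by apply/funext => s; apply/funext => u; rewrite pE ext_dD.
  by rewrite mod_exact_ext_d //; exact: smooth_funD.
move=> Hb; exists alpha; first exact: mem_class.
by rewrite /= pE mod_exact_ext_d.
Qed.

End Forms.

(** * Failure of transitivity *)

Section NotTransitive.
Variables (R : realType) (n : nat) (S M : manifold R n).
Variables (muS : nform S) (muM : nform M) (phi : S -> M) (p q : S) (f : M -> R).
Hypothesis M_boundaryless : @boundary R n M = set0.
Hypothesis phi_vol : Emb_vol muS muM phi.
Hypotheses (p_bd : boundary p) (q_bd : boundary q) (pq_linked : linked R p q).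
Hypotheses (sf : smooth_fun f) (fp : f (phi p) != 0) (fq : f (phi q) = 0).

Let smphi : smooth_map phi. Proof. by have [[]] := phi_vol. Qed.
Let k s := f (phi s).
Let sk : smooth_fun k. Proof. exact: smooth_fun_comp. Qed.

(** Otherwise [k + h] would be locally constant and would agree at the linked
    points [p] and [q], where [h] vanishes and [k] takes different values. *)
Lemma no_boundary_primitive (h : S -> R) : smooth_fun h ->
  (forall s, boundary s -> h s = 0) ->
  ~ forall c x v (U : set 'rV[R]_n), @atlas R n S c -> open U -> U `<=` img c ->
      U x -> dirder c x v k + dirder c x v h = 0.
Proof.
move=> sh h0 dkh; have lc : locally_constant (fun s => k s + h s).
  apply: zero_dirder_locally_constant; first exact: smooth_funD.
  move=> c x v U ac oU Uc Ux; have tx := tangent_dirder v ac oU Uc Ux.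
  by rewrite (tangentD tx sk sh); exact: dkh oU Uc Ux.
have := pq_linked lc; rewrite /k /= fq !h0 // !addr0 => E.
by move: fp; rewrite E eqxx.
Qed.

(** The classes of [0] and of [df] along [phi] lie on the same level set. A
    diffeomorphism [eta] taking one to the other satisfies [eta \o phi = phi],
    so it moves no vector of the form [push phi u] and leaves pull-backs by
    [phi] unchanged. Hence [d k] is the differential of a function that vanishes
    on the boundary. *)
Lemma not_group_transitive : ~ group_transitive_on_levels muS muM.
Proof.
move=> Htr.
have o0 := d_along_oneform smphi 0 sf; have o1 := d_along_oneform smphi 1 sf.
have [|||eta [seta _ _] actE] :=
  Htr (class phi (d_along phi 0 f)) (class phi (d_along phi 1 f)).
- by exists phi, (d_along phi 0 f).
- by exists phi, (d_along phi 1 f).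
- rewrite (J_R_exact o0 _ (pull_d_along smphi 0 sf)); last exact: smooth_funZ.
  by rewrite (J_R_exact o1 _ (pull_d_along smphi 1 sf)) //; exact: smooth_funZ.
have phiE : eta \o phi = phi := congr1 fst actE.
have : (act eta (class phi (d_along phi 0 f))).2 (d_along phi 1 f).
  by rewrite actE; exact: mem_class.
move=> [_ [alpha0 [oa0 [h0 [sh0 h0bd h0E]]] lift]].
apply: (@no_boundary_primitive (fun s => -1 * h0 s)).
- exact: smooth_funZ.
- by move=> s /h0bd ->; rewrite mulr0.
move=> c x v U ac oU Uc Ux; have tx := tangent_dirder v ac oU Uc Ux.
rewrite (tangentZ tx _ sh0) mulN1r; apply/eqP; rewrite subr_eq0; apply/eqP.
have tp := tangent_push smphi tx.
have := lift _ _ tp; rewrite push_comp // phiE.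
have -> : d_along phi 1 f (param c x) (push phi (dirder c x v)) = dirder c x v k.
  by rewrite /d_along mul1r (ext_d_tangent _ tp) pushE.
move=> ->.
have := congr1 (fun F => F (param c x) (dirder c x v)) h0E.
rewrite /= (pull_d_along smphi 0 sf) {1}/pull asboolT // => ->.
by rewrite !(ext_d_tangent _ tx) (tangentZ tx 0 sk) mul0r add0r.
Qed.

Let line : curve S M := fun t => (phi, d_along phi t f).

Lemma line_smooth : smooth_curve muS muM line.
Proof.
split=> //.
- by move=> t; exact: d_along_oneform.
- split.
    move=> x; apply: (@continuous_comp _ _ _ snd phi); first exact: cvg_snd.
    exact: smphi.1.
  by move=> c d ac ad; exact: (smooth_on_rsubmx (smphi.2 c d ac ad)).
- move=> X [tX sX] /=.
  have -> : (fun t s => d_along phi t f s (X (phi s))) =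
      (fun t s => t * ((fun p => X p f) \o phi) s).
    by apply/funext => t; apply/funext => s; rewrite /d_along ext_d_tangent.
  by apply: smooth_fun_family_scale; apply: smooth_fun_comp => //; exact: sX.
Qed.

Lemma line_velocity : velocity muS muM line line.
Proof.
split; first exact: line_smooth.
exists line, (fun _ _ => 0); split=> //.
- exact: line_smooth.
- split=> // c ac; exact: smooth_on_cst.
- by move=> t; apply/funext => s; apply/funext => u; rewrite ext_d0 addr0.
Qed.

Lemma line_kernel :
  ker_TJ_R muS muM (class phi (d_along phi 0 f)) (velocity muS muM line).
Proof.
exists line => //; split; first by split; [exact: line_smooth|].
rewrite /TJ_R -(mod_exact_ext_d sk); congr mod_exact.
apply/funext => s; apply/funext => u.
have -> : (fun t : R => pull (line t).1 (line t).2 s u : R^o) =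
    (fun t : R => id t * ext_d k s u).
  by apply/funext => t; rewrite /= pull_d_along // ext_dZ.
by rewrite derive1Mr ?derive1_id ?mul1r //; exact: derivable_id.
Qed.

(** As the base point of [e] is constant in time and [c] has the same velocity,
    [xi] vanishes on the image of [phi], and its flow fixes this image pointwise
    by [stationary_flow]. *)
Lemma fixed_flow (xi : M -> tvec M) (c e : curve S M) :
  vector_field xi -> lifted_flow_line xi c -> same_velocity_lift c e ->
  (forall t, (e t).1 = phi) ->
  exists (Fl : R -> M -> M) (eps : R), [/\ 0 < eps,
    forall t, smooth_map (Fl t), forall t, `|t| < eps -> Fl t \o phi = phi &
    forall t, `|t| < eps -> (c t).1 = phi /\
      cotangent_lift (Fl t) phi (c 0).2 (c t).2].
Proof.
move=> Vxi [Fl [U [eps [sFl [oU phiU] eps0 flow clift]]]] [c0 basev _] ephi.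
have c0phi : (c 0).1 = phi by rewrite c0 ephi.
rewrite c0phi in clift phiU.
have Fl0 s : Fl 0 (phi s) = phi s.
  by have [] := flow (phi s) (phiU _ (ex_intro2 _ _ s I erefl)).
have dFl s t : `|t| < eps -> forall g, smooth_fun g ->
    is_derive (t : R^o) (1 : R^o) (fun r => g (Fl r (phi s)) : R^o)
      (xi (Fl t (phi s)) g).
  by have [_] := flow (phi s) (phiU _ (ex_intro2 _ _ s I erefl)); apply.
have xi0 s g : smooth_fun g -> xi (phi s) g = 0.
  move=> sg; have := basev g s sg.
  rewrite (@derive1_near_cst R (fun t => g ((e t).1 s)) (g (phi s))); last first.
    by near=> t; rewrite ephi.
  have z0 : `|0 : R| < eps by rewrite normr0.
  have [_] := dFl s 0 z0 g sg; rewrite Fl0 => <- H.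
  have nc : \forall t \near (0 : R), g ((c t).1 s) = g (Fl t (phi s)).
    near=> t; have te : `|t| < eps by near: t; exact: near_ball0.
    by have [-> _] := clift t te.
  apply: etrans H; rewrite derive1E; apply/esym.
  exact: (@near_eq_derive R R^o R^o _ _ _ 1 nc).
have fix_phi t : `|t| < eps -> Fl t \o phi = phi.
  move=> te; apply/funext => s /=.
  apply: (stationary_flow M_boundaryless Vxi (xi0 s) _ eps0 (Fl0 s) (dFl s) te).
  move=> r; have cp : {for r, continuous (fun r : R => (r, phi s) : R * M)}.
    move=> A [[P Q] /= [Pr Qs] PQ]; apply: filterS Pr => r' Pr'.
    by apply: (PQ (r', phi s)); split=> //=; exact: nbhs_singleton Qs.
  exact: (@continuous_comp _ _ _ _ (fun z : R * M => Fl z.1 z.2) r cp (sFl.1 _)).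
exists Fl, eps; split=> //; first by move=> t; exact: smooth_map_slice.
move=> t te; have [ct lt] := clift t te; split=> //.
by rewrite ct; exact: fix_phi.
Unshelve. all: by end_near. Qed.

(** The velocity of [line] at [0] is in the kernel. If [xi] generates it, then
    along the lifted flow the covector at [s] has a constant value on [push phi
    u], by [fixed_flow]. The curve [e], which has the same velocity, takes the
    value [t * u k + u (h t)] there. Hence [u k + u h' = 0] for the time
    derivative [h'] of [h], which vanishes on the boundary. *)
Lemma not_lie_algebra_transitive : ~ lie_algebra_transitive_on_levels muS muM.
Proof.
move=> Htr.
have o0 := d_along_oneform smphi 0 sf.
have Tm : TstarEmb_vol muS muM (class phi (d_along phi 0 f)).
  by exists phi, (d_along phi 0 f).
have : ker_TJ_R muS muM (class phi (d_along phi 0 f)) (velocity muS muM line).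
  exact: line_kernel.
rewrite -(Htr _ Tm) => -[xi [Vxi _] genE].
have : generator muS muM xi (class phi (d_along phi 0 f)) line.
  by rewrite genE; exact: line_velocity.
move=> [c [_ flow_c] [_ [e [h [se [sh hbd] ephi eE same]]]]].
have [Fl [eps [eps0 sFl Flphi clift]]] := fixed_flow Vxi flow_c same ephi.
have [_ _ vel] := same.
have sdh := smooth_time_derivative sh.
apply: (@no_boundary_primitive (time_derivative h)).
- exact: sdh.
- move=> s bs; rewrite /time_derivative.
  by apply: (@derive1_near_cst R (h^~ s) 0); near=> t; exact: hbd.
move=> ch x v U ac oU Uc Ux; set s := param ch x; set u := dirder ch x v.
have tu : tangent s u := tangent_dirder v ac oU Uc Ux.
have tp : tangent (phi s) (push phi u) := tangent_push smphi tu.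
have [d ad dx] := atlas_cover (phi s).
have [w uw] := push_dirder smphi M_boundaryless v ac ad oU Uc Ux dx.
have [X VX Xs] := vector_field_extension M_boundaryless w ad dx.
rewrite -uw -/s -/u in Xs.
(* Left: the constant value of the flow line on [push phi u]; right: the curve
   [e], whose value is affine in [t] up to [u (h t)]. *)
have := vel X s VX.
rewrite (@derive1_near_cst R (fun t => (c t).2 s (X ((c t).1 s)))
  ((c 0).2 s (push phi u))); last first.
  near=> t; have te : `|t| < eps by near: t; exact: near_ball0.
  have [-> lift] := clift t te; rewrite Xs -(lift _ _ tp).
  by rewrite push_comp // Flphi.
have -> : (fun t => (e t).2 s (X ((e t).1 s)) : R^o) =
    (fun t : R => id t * u k + dirder ch x v (h t)).
  apply/funext => t; rewrite ephi Xs.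
  have := congr1 (fun F => F s u) (eE t).
  rewrite /= ephi {1}/pull asboolT // => ->.
  by rewrite pull_d_along // !(ext_d_tangent _ tu) (tangentZ tu _ sk).
have [d1 d2] := dirder_time_derivative v sh ac oU Uc Ux.
have dk : derivable (fun t : R => id t * u k : R^o) 0 1.
  by apply: derivableM; [exact: derivable_id|exact: derivable_cst].
rewrite derive1E deriveD // d2 -derive1E derive1Mr ?derive1_id ?mul1r //.
Unshelve. all: by end_near. Qed.

End NotTransitive.

Theorem proposition5p3 (R : realType) (n : nat) (S M : manifold R n)
    (muS : nform S) (muM : nform M)
    (S_compact : compact [set: S])
    (S_boundary : @boundary R n S !=set0)
    (M_boundaryless : @boundary R n M = set0)
    (muS_volume : volume_form muS) (muM_volume : volume_form muM)
    (Emb_nonempty : Emb_vol muS muM !=set0) :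
  ~ lie_algebra_transitive_on_levels muS muM /\
  ~ group_transitive_on_levels muS muM.
Proof.
have [p [q [p_bd q_bd pq lpq]]] := linked_boundary_points S_compact S_boundary.
have [phi phi_vol] := Emb_nonempty.
have [[_ _ phi_inj _] _] := phi_vol.
have [|f [sf fp fq]] := separating_smooth_fun M_boundaryless (x := phi p) (y := phi q).
  by move=> /phi_inj.
split.
  exact: (not_lie_algebra_transitive M_boundaryless phi_vol p_bd q_bd lpq sf fp fq).
exact: (not_group_transitive phi_vol p_bd q_bd lpq sf fp fq).
Qed.
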